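(* Let $s\geq 2$, let $k_1\ge k_2\ge\dots\ge k_s\ge 3$ be integers, and let $H := C_{k_1}\sqcup\dots\sqcup C_{k_s}$ be the disjoint union of cycles of lengths $k_1,\dots,k_s$. Then for all sufficiently large $n$ (depending on $H$), $$\log_{k_1-1}(n)-1\;\le\; M_H(n)\;<\;\log_{k_1-1}(n)+6s^6k_1^2 .$$
   Context: All graphs are finite and simple. For graphs $H$, $G$, let $n_H(G)$ be the number of copies of $H$ in $G$ (not necessarily induced subgraphs isomorphic to $H$). The $H$-bootstrap process (or $H$-process) on $G$ is the sequence $(G_i)_{i\ge 0}$ with $G_0=G$, $V(G_i)=V(G)$ and, for $i\ge 1$, $E(G_i)=E(G_{i-1})\cup\{e\in\binom{V(G)}{2}: n_H(G_{i-1}+e)>n_H(G_{i-1})\}$. The running time is $\tau_H(G)=\min\{t\ge 0: G_t=G_{t+1}\}$, and $M_H(n)=\max\{\tau_H(G): |V(G)|=n\}$. *)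

(* Defs.v *)
From mathcomp Require Import all_boot all_order all_algebra.
From mathcomp Require Import reals exp.

Set Implicit Arguments.
Unset Strict Implicit.
Unset Printing Implicit Defensive.

(* A graph on the vertex set T is given by its edge set E : {set {set T}};
   it is a finite simple graph when every edge has exactly two elements. *)
Definition simple_graph (T : finType) (E : {set {set T}}) : bool :=
  [forall e in E, #|e| == 2].

(* Simple for 3 <= k. *)
Definition cycle_graph (k : nat) : {set {set 'I_k}} :=
  [set [set i; ordS i] | i : 'I_k].

Definition disjoint_union (I : finType) (V : I -> finType)
    (E : forall i, {set {set V i}}) : {set {set {i : I & V i}}} :=
  \bigcup_(i : I) [set Tagged V @: e | e : {set V i} in E i].

Definition union_of_cycles (s : nat) (k : s.-tuple nat) :
    {set {set {i : 'I_s & 'I_(tnth k i)}}} :=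
  disjoint_union (V := fun i => 'I_(tnth k i))
    (fun i => cycle_graph (tnth k i)).

Section Bootstrap.

Variables (U : finType) (H : {set {set U}}).

Section Process.

Variable T : finType.
Implicit Types (G : {set {set T}}) (W : {set T}) (F : {set {set T}}).

(* The pair (W, F), with vertex set W and edge set F, is isomorphic to H. *)
Definition isomorphic_to_pattern W F : bool :=
  [exists f : {ffun U -> T},
    [&& injectiveb f, f @: [set: U] == W
      & [set f @: e | e : {set U} in H] == F]].

Definition copies G : {set {set T} * {set {set T}}} :=
  [set S : {set T} * {set {set T}} |
    (S.2 \subset G) && isomorphic_to_pattern S.1 S.2].

Definition num_copies G : nat := #|copies G|.

Definition bootstrap_step G : {set {set T}} :=
  G :|: [set e : {set T} | (#|e| == 2) && (num_copies G < num_copies (e |: G))].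

Definition bootstrap_process G (i : nat) : {set {set T}} :=
  iter i bootstrap_step G.

Lemma bootstrap_process_stabilises G :
  exists t, bootstrap_process G t == bootstrap_process G t.+1.
Proof.
pose P := bootstrap_process G.
have sub t : P t \subset P t.+1 by apply: subsetUl.
case: (boolP [exists t : 'I_(#|{set T}|.+1), P t == P t.+1]).
  by case/existsP=> t Pt; exists t.
rewrite negb_exists => /forallP neq.
have grow t : t <= #|{set T}|.+1 -> t <= #|P t|.
  elim: t => // t IH lt_t; apply: leq_ltn_trans (IH (ltnW lt_t)) _.
  by apply: proper_card; rewrite properEneq sub andbT (neq (Ordinal lt_t)).
by have := leq_trans (grow _ (leqnn _)) (max_card _); rewrite ltnn.
Qed.

Definition running_time G : nat := ex_minn (bootstrap_process_stabilises G).

End Process.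

(* Running times are invariant under isomorphism, so it suffices to let G
   range over the simple graphs with vertex set 'I_n. *)
Definition max_running_time (n : nat) : nat :=
  \max_(G : {set {set 'I_n}} | simple_graph G) running_time G.

End Bootstrap.

Definition log_base (R : realType) (b x : R) : R := (ln x / ln b)%R.

(* Main.v *)
Require Import Defs.
From mathcomp Require Import all_boot all_order all_algebra.
From mathcomp Require Import reals exp.
From mathcomp Require Import boolp zify.

Set Implicit Arguments.
Unset Strict Implicit.
Unset Printing Implicit Defensive.

(** Write [q = k1 - 1].

    A new edge closes a path on [k_j] vertices, so distances shrink by a factor
    of at most [q] per step.  A long path together with a disjoint copy of [H]
    therefore needs [log_q n - 1] steps: as long as the ends of the path are at
    distance at least [q], a shortest path between them still gets a new chord.

    For the upper bound, fix a large constant [L].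
    If [G] has no path on [L] vertices, it has bounded tree-depth, so a graph
    that is large enough contains many disjoint isomorphic branches that can be
    exchanged by automorphisms.  Deleting one of them does not make the process
    shorter, so the running time is bounded by a constant, and a constant is
    absorbed by [log_q n].
    If [G] has a path on [L] vertices, then (unless nothing happens) [G_1]
    contains a copy of [H], and closing pieces of the long path produces so many
    disjoint copies of [H] in [G_2] that from then on every path on [k_j]
    vertices is closed.  In this free process the diameter of a component is
    divided by [q] at each step, so it is [O(q)] after [log_q n + 1] steps; then
    a component that still changes contains a cycle, and its vertices attach to
    the two sides of the cycle until, after [O(q^2)] further steps, it is
    complete, complete bipartite, or as small as the cycle. *)

(** * The free process *)

(** A chain that grew at each of the first [#|S|.+1] steps would have more elements than [S]. *)
Lemma nested_sets_stall (T : finType) (S : {set T}) (F : nat -> {set T}) :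
    (forall t, F t \subset F t.+1) -> (forall t, F t \subset S) ->
  exists2 t, t <= #|S| & F t = F t.+1.
Proof.
move=> Fmono FS; suff: exists t : 'I_(#|S|.+1), F t == F t.+1.
  by case=> t /eqP eqF; exists t; rewrite // -ltnS.
apply/existsP; rewrite -[X in is_true X]negbK negb_exists; apply/forallP => neq.
have grow t : t <= #|S|.+1 -> t <= #|F t|.
  elim: t => // t IH lt_t; apply: leq_ltn_trans (IH (ltnW lt_t)) _.
  by apply: proper_card; rewrite properEneq Fmono andbT (neq (Ordinal lt_t)).
by have := leq_trans (grow _ (leqnn _)) (subset_leq_card (FS _)); rewrite ltnn.
Qed.

(** A cycle is a periodic sequence indexed by all of [nat], so that an arc may start anywhere and
    run past position [a] without reductions modulo [a]. *)
Definition is_cycle (T : finType) (a : nat) (r : rel T) (c : nat -> T) :=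
  [/\ forall i, c (i + a) = c i,
      forall i j, c i = c j -> i = j %[mod a]
    & forall i, r (c i) (c i.+1)].

Section CycleParametrisation.

Variables (T : finType) (a : nat) (r : rel T) (c : nat -> T).
Hypotheses (a_gt0 : 0 < a) (c_cycle : is_cycle a r c).

Lemma cycle_addM i m : c (i + m * a) = c i.
Proof.
have [per _ _] := c_cycle; elim: m => [|m IH]; first by rewrite addn0.
by rewrite mulSn (addnC a) addnA per.
Qed.

Lemma cycle_mod i : c (i %% a) = c i.
Proof. by rewrite {2}(divn_eq i a) addnC cycle_addM. Qed.

Lemma cycle_modP i j : c i = c j <-> i = j %[mod a].
Proof.
have [_ inj _] := c_cycle; split; first exact: inj.
by move=> eq; rewrite -cycle_mod eq cycle_mod.
Qed.

Lemma cycle_neq i j : i < j < i + a -> c i != c j.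
Proof.
move=> /andP[lt_ij lt_ja]; apply/eqP => /cycle_modP /eqP.
have -> : j = i + (j - i) by lia.
rewrite -[X in X == _ %[mod _]]addn0 eqn_modDl mod0n modn_small; last by lia.
by lia.
Qed.

Definition on_cycle u := [exists i : 'I_a, u == c i].

Lemma on_cycleP u : reflect (exists i, u = c i) (on_cycle u).
Proof.
apply: (iffP existsP) => [[i /eqP ->]|[i ->]]; first by exists i.
by exists (Ordinal (ltn_pmod i a_gt0)); rewrite /= cycle_mod.
Qed.

Lemma on_cycle_at i : on_cycle (c i).
Proof. by apply/on_cycleP; exists i. Qed.

Lemma off_cycle_neq u i : ~~ on_cycle u -> u != c i.
Proof. by apply: contraNneq => ->; apply: on_cycle_at. Qed.

Definition arc i l := [seq c m | m <- iota i.+1 l].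

Lemma size_arc i l : size (arc i l) = l.
Proof. by rewrite size_map size_iota. Qed.

Lemma arc_path i l : path r (c i) (arc i l).
Proof.
have [_ _ adj] := c_cycle.
by elim: l i => //= l IH i; rewrite adj; apply: IH.
Qed.

Lemma last_arc i l : last (c i) (arc i l) = c (i + l).
Proof. by elim: l i => [|l IH] i; rewrite /= ?addn0 // (IH i.+1) addSnnS. Qed.

Lemma arc_uniq i l : l < a -> uniq (c i :: arc i l).
Proof.
move=> lt_la; rewrite -[_ :: _]/[seq c m | m <- iota i l.+1].
rewrite map_inj_in_uniq ?iota_uniq // => x y.
rewrite !mem_iota => Hx Hy cxy.
have [lt_xy|lt_yx|//] := ltngtP x y.
  by have := @cycle_neq x y; rewrite cxy eqxx; lia.
by have := @cycle_neq y x; rewrite cxy eqxx; lia.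
Qed.

Lemma off_arc u i l : ~~ on_cycle u -> u \notin c i :: arc i l.
Proof.
move=> u_off; rewrite -[_ :: _]/[seq c m | m <- iota i l.+1].
by apply/mapP => -[m _]; apply/eqP/off_cycle_neq.
Qed.

(* Positions that agree modulo the subgroup of Z/a generated by 2. *)
Definition same_side i j := odd a || (odd i == odd j).

Lemma same_side_step i j :
  same_side i j -> exists2 l, l <= a & i = j + l.*2 %[mod a].
Proof.
move=> ss_ij; pose d := (i + (a - j %% a)) %% a.
have lt_jm := ltn_pmod j a_gt0; have lt_d : d < a by rewrite ltn_mod.
have dE : i = j + d %[mod a].
  rewrite /d -(modnDml j) modnDmr addnCA subnKC; last by lia.
  by rewrite modnDr.
case: (boolP (odd d)) => d_odd; last first.
  exists d./2; first by lia.
  by rewrite halfK (negbTE d_odd) subn0.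
have a_odd : odd a.
  case/orP: ss_ij => // /eqP; apply: contra_eqT => a_even.
  rewrite -(odd_mod i (negbTE a_even)) dE odd_mod ?(negbTE a_even) //.
  by rewrite oddD d_odd addbT; case: (odd j).
(* An odd difference can occur only for odd [a]; one more turn around the cycle makes it even. *)
exists (d + a)./2; first by lia.
have -> : (d + a)./2.*2 = d + a.
  by rewrite halfK oddD d_odd a_odd subn0.
by rewrite addnA modnDr.
Qed.

End CycleParametrisation.

(** * Paths alternating between two sets *)

Fixpoint alternate (T : Type) (s1 s2 : seq T) : seq T :=
  if (s1, s2) is (b :: s1', a :: s2') then b :: a :: alternate s1' s2' else [::].

Section Alternate.

Variables (T : eqType) (r : rel T).

Lemma alternate_path x (s1 s2 : seq T) : symmetric r ->
    (forall b, b \in s1 -> r x b) ->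
    (forall b a, b \in s1 -> a \in s2 -> r b a) ->
  path r x (alternate s1 s2).
Proof.
move=> rC; elim: s1 s2 x => [|b s1 IH] [|a s2] x //= rx rs.
rewrite rx ?rs ?mem_head //=; apply: IH => [b' s1b|b' a' s1b s2a].
  by rewrite rC rs ?mem_head // in_cons s1b orbT.
by rewrite rs // in_cons ?s1b ?s2a orbT.
Qed.

Lemma last_alternate (x : T) s1 s2 : last x (alternate s1 s2) \in x :: s2.
Proof.
elim: s1 s2 x => [|b s1 IH] [|a s2] x //=; rewrite ?mem_head //.
by rewrite in_cons IH orbT.
Qed.

Lemma perm_alternate (s1 s2 : seq T) : size s1 = size s2 ->
  perm_eq (alternate s1 s2) (s1 ++ s2).
Proof.
elim: s1 s2 => [|b s1 IH] [|a s2] //= [/IH] {}IH.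
by rewrite /= perm_cons perm_sym -cat1s perm_catCA /= perm_cons perm_sym.
Qed.

End Alternate.

Lemma subset_of_size (T : finType) (S : {set T}) m : m <= #|S| ->
  exists s, [/\ size s = m, uniq s & {subset s <= S}].
Proof.
move=> le; exists (take m (enum S)); split.
- by rewrite size_takel // -cardE.
- by rewrite take_uniq // enum_uniq.
- by move=> x /mem_take; rewrite mem_enum.
Qed.

Lemma path_first_exit (T : eqType) (r : rel T) (P : pred T) x p :
    path r x p -> P x -> ~~ P (last x p) ->
  exists u w, [/\ P u, ~~ P w & r u w].
Proof.
elim: p x => [|y p IH] x /=; first by move=> _ ->.
case/andP=> xy yp Px nP; have [Py|nPy] := boolP (P y); first exact: IH nP.
by exists x, y.
Qed.

(** * The abstract process in which a step closes every path on [k_j] vertices and adds nothing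
    else *)

Section FreeProcess.

Variables (T : finType) (ks : seq nat) (A : nat -> rel T).
Hypotheses (ks_ge3 : all (leq 3) ks)
  (A_sym : forall t, symmetric (A t)) (A_irr : forall t, irreflexive (A t))
  (A_step : forall t, subrel (A t) (A t.+1))
  (A_close : forall t x p, (size p).+1 \in ks -> uniq (x :: p) ->
     path (A t) x p -> A t.+1 x (last x p))
  (A_new : forall t x y, A t.+1 x y -> ~~ A t x y -> exists p,
     [/\ (size p).+1 \in ks, uniq (x :: p), path (A t) x p & last x p = y]).

Lemma A_le t t' : t <= t' -> subrel (A t) (A t').
Proof.
elim: t' => [|t' IH]; first by rewrite leqn0 => /eqP ->.
by rewrite leq_eqVlt => /predU1P[-> //|/IH le x y /le]; apply: A_step.
Qed.

Lemma path_le t t' x p : t <= t' -> path (A t) x p -> path (A t') x p.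
Proof. by move/A_le=> le; apply: sub_path. Qed.

Lemma is_cycle_le t t' a c : t <= t' -> is_cycle a (A t) c -> is_cycle a (A t') c.
Proof. by move=> le [? ? adj]; split=> // i; apply: A_le le _ _ (adj i). Qed.

(** A new edge joins the ends of an existing path, so components never merge. *)
Lemma A_connect t t' x y : t <= t' -> A t' x y -> connect (A t) x y.
Proof.
elim: t' x y => [|t' IH] x y; first by rewrite leqn0 => /eqP ->; apply: connect1.
rewrite leq_eqVlt => /predU1P[-> //|le]; first exact: connect1.
move=> Axy; have [/IH-> //|/(A_new Axy)[p [_ _ p_path <-]]] := boolP (A t' x y).
elim: p x p_path {Axy} => //= z p IHp x /andP[xz /IHp]; apply: connect_trans.
exact: IH.
Qed.

Lemma A_connect_sym t : connect_sym (A t).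
Proof. exact: sym_connect_sym. Qed.

Definition settled t (C : pred T) := {in C &, forall x y, A t.+1 x y = A t x y}.

(** A path that closes inside the component at a later time uses only edges present at time [s], by
    induction; so it was closed at time [s.+1], hence its chord was present at time [s]. Components
    being constant keeps the path inside [C]. *)
Lemma settled_le t s s' x0 : t <= s <= s' ->
  settled s (connect (A t) x0) -> settled s' (connect (A t) x0).
Proof.
set C := connect _ _ => /andP[le_ts le_ss'] st.
have stays i : t <= i -> forall x y, x \in C -> A i x y -> y \in C.
  by move=> le x y xC /(A_connect le); apply: connect_trans.
have eqA i : s <= i -> {in C &, forall x y, A i x y = A s x y}.
  elim: i => [|i IH]; first by rewrite leqn0 => /eqP ->.
  rewrite leq_eqVlt => /predU1P[-> //|]; rewrite ltnS => le x y xC yC.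
  apply/idP/idP; last by apply: A_le; apply: leqW.
  have [Axy _|nA /A_new/(_ nA)[p [ps pu pp <-]]] := boolP (A i x y).
    by rewrite -IH.
  have le_ti := leq_trans le_ts le.
  have [pt lC] : path (A s) x p /\ last x p \in C.
    elim: p x xC pp {yC nA ps pu} => //= z p IHp x xC /andP[xz pz].
    have zC := stays _ le_ti _ _ xC xz.
    by have [pt lC] := IHp z zC pz; rewrite -IH // xz.
  by rewrite -st //; apply: A_close.
by move=> x y xC yC; rewrite !eqA // leqW.
Qed.

(** * A cycle of length [a] and the vertices attached to it *)

Section Cycle.

Variable a : nat.
Implicit Type c : nat -> T.
Hypothesis a_ks : a \in ks.

Let a_ge3 : 2 < a. Proof. exact: (allP ks_ge3). Qed.
Let a_gt0 : 0 < a. Proof. by lia. Qed.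

Local Notation on := (on_cycle a).

(** The path from [w] to [c (i + 2)] and along the cycle to [c (i + a) = c i] skips only
    [c (i + 1)], so it has [a] vertices. *)
Lemma spread_step t c w i : is_cycle a (A t) c -> ~~ on c w ->
  A t w (c (i + 2)) -> A t.+1 w (c i).
Proof.
move=> cyc w_off w_adj.
have -> : c i = last w (c (i + 2) :: arc c (i + 2) (a - 2)).
  rewrite /= last_arc -addnA subnKC; last by lia.
  by case: cyc.
apply: A_close.
- by rewrite /= size_arc; have -> : (a - 2).+2 = a by lia.
- by rewrite cons_uniq (off_arc a_gt0 cyc) // (arc_uniq a_gt0 cyc) //; lia.
- by rewrite /= w_adj (arc_path cyc).
Qed.

Lemma spread t c w i j : is_cycle a (A t) c -> ~~ on c w -> A t w (c i) ->
  same_side a i j -> A (t + a) w (c j).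
Proof.
move=> cyc w_off w_adj /(same_side_step a_gt0)[l le_la].
move/(cycle_modP cyc) => ci; rewrite {}ci in w_adj.
apply: (@A_le (t + l)); first by rewrite leq_add2l.
elim: l j w_adj {le_la} => [|l IH] j w_adj; first by rewrite !addn0 in w_adj *.
rewrite addnS; apply: spread_step => //; first by apply: is_cycle_le cyc; lia.
by apply: IH; rewrite -addnA add2n -doubleS.
Qed.

(** Both neighbours of [c i] on the cycle lie on the side of [i.+1], so [w] can take the place of
    [c i]. *)
Lemma cycle_subst t c w i : is_cycle a (A t) c -> ~~ on c w ->
  (forall j, same_side a j i.+1 -> A t w (c j)) ->
  is_cycle a (A t) (fun m => if m %% a == i %% a then w else c m).
Proof.
move=> cyc w_off w_adj; have [per inj adj] := cyc; split.
- by move=> m; rewrite modnDr per.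
- move=> m m'; case: eqP => [-> |_]; case: eqP => [-> //|_].
  + by move=> wc; have := off_cycle_neq a_gt0 cyc m' w_off; rewrite wc eqxx.
  + by move=> wc; have := off_cycle_neq a_gt0 cyc m w_off; rewrite wc eqxx.
  exact: inj.
- have par x y : x %% a = y %% a -> same_side a x.+1 y.+1.
    rewrite /same_side; case: (boolP (odd a)) => //= a_even eq; apply/eqP.
    by rewrite /= -(odd_mod x (negbTE a_even)) eq odd_mod ?(negbTE a_even).
  move=> m; case: eqP => [mi|_]; case: eqP => [mi'|_] //; last first.
  + rewrite A_sym; apply: w_adj; move: (par _ _ mi').
    by rewrite /same_side /= negbK.
  + apply: w_adj; exact: par.
  + have := cycle_neq a_gt0 cyc (i := m) (j := m.+1).
    by rewrite -(cycle_mod cyc m) -(cycle_mod cyc m.+1) mi mi' eqxx; lia.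
Qed.

(** After [a] steps [w] is adjacent to a whole side and can replace [c i]. Then [c i] is an outside
    vertex of the new cycle, adjacent to [c i.+1], and spreads over that side in [a] more steps. *)
Lemma cycle_bipartite t c w i0 i j : is_cycle a (A t) c -> ~~ on c w ->
  A t w (c i0) -> same_side a i.+1 j -> c i != c j -> A (t + a + a) (c i) (c j).
Proof.
move=> cyc w_off w_adj.
(* If [i.+1] is not on the side that [w] reaches, then [j.+1] is, and [i] and [j] change roles. *)
wlog ss0 : i j / same_side a i0 i.+1 => [wl|].
  move=> ssij cij; have [/wl->//|ss0] := boolP (same_side a i0 i.+1).
  rewrite A_sym; apply: wl; rewrite 1?eq_sym //; move: ss0 ssij;
    by rewrite /same_side; case: (odd a) => //=; case: (odd i); case: (odd j); case: (odd i0).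
move=> ssij cij.
have w_all m : same_side a m i.+1 -> A (t + a) w (c m).
  move=> ss; apply: (spread cyc w_off w_adj); move: ss ss0.
  by rewrite /same_side; case: (odd a) => //=; case: (odd i); case: (odd m); case: (odd i0).
have cyc' := is_cycle_le (leq_addr a t) cyc.
have csub := cycle_subst cyc' w_off w_all.
have ne m : c i != c m -> (m %% a == i %% a) = false.
  by apply: contra_neqF => /eqP mi; rewrite -(cycle_mod cyc i) -mi (cycle_mod cyc).
suff: A (t + a + a) (c i) ((fun m => if m %% a == i %% a then w else c m) j).
  by rewrite /= ne.
apply: (spread csub) ssij.
  apply/(on_cycleP a_gt0 csub) => -[m] /=; case: ifP => [_ cw|mi].
    by have := off_cycle_neq a_gt0 cyc i w_off; rewrite cw eqxx.
  by move/(cycle_modP cyc) => im; rewrite im eqxx in mi.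
rewrite ne; last by apply: (cycle_neq a_gt0 cyc); lia.
by have [_ _] := cyc'; apply.
Qed.

(* For even [a] the cycle forces a complete bipartite graph: vertices of side
   [i] behave like [c i].  For odd [a] there is only one side. *)
Definition side t c i u :=
  (exists2 j, same_side a i j & u = c j) \/
  (~~ on c u /\ forall j, same_side a i.+1 j -> A t u (c j)).

Lemma side_le t t' c i u : t <= t' -> side t c i u -> side t' c i u.
Proof.
move=> le [?|[u_off u_adj]]; [by left|right; split=> // j /u_adj].
exact: A_le.
Qed.

Lemma same_side_trans : transitive (same_side a).
Proof. by move=> j i k; rewrite /same_side; case: odd => //= /eqP -> /eqP ->. Qed.

Lemma same_side_sym : symmetric (same_side a).
Proof. by move=> i j; rewrite /same_side eq_sym. Qed.

Lemma same_sideS i j : same_side a i.+1 j.+1 = same_side a i j.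
Proof. by rewrite /same_side /=; case: odd => //=; case: (odd i); case: (odd j). Qed.

Lemma same_side2 i j : same_side a i.+2 j = same_side a i j.
Proof. by rewrite /same_side /= negbK. Qed.

Lemma side_eq t c i j u : same_side a i j -> side t c i u -> side t c j u.
Proof.
rewrite same_side_sym => ss [[m sm ->]|[u_off u_adj]]; [left|right; split=> //].
  by exists m => //; apply: same_side_trans sm.
by move=> m sm; apply: u_adj; apply: same_side_trans sm; rewrite same_sideS same_side_sym.
Qed.

Lemma side01 t c i u : side t c i u -> side t c 0 u \/ side t c 1 u.
Proof.
move=> su; have [/side_eq/(_ su)|ns] := boolP (same_side a i 0); first by left.
right; apply: side_eq su; move: ns.
by rewrite /same_side; case: odd => //=; case: odd.
Qed.

Lemma on_side t c u : is_cycle a (A t) c -> on c u -> side t c 0 u \/ side t c 1 u.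
Proof.
move=> cyc /(on_cycleP a_gt0 cyc)[i ->]; apply: (@side01 _ _ i); left; exists i => //.
by rewrite /same_side eqxx orbT.
Qed.

(** The path [w], [u], [c (j + 3)], ..., [c (j + a) = c j] skips [c (j + 1)] and [c (j + 2)], so it
    has [a] vertices. *)
Lemma side_spread t c i u w : is_cycle a (A t) c -> side t c i u -> ~~ on c u ->
  ~~ on c w -> A t u w -> side t.+1 c i.+1 w.
Proof.
move=> cyc [[j _ ->]|[_ u_adj] u_off w_off uw].
  by rewrite (on_cycle_at a_gt0 cyc).
right; split=> // j; rewrite same_side2 => ss.
have -> : c j = last w (u :: c (j + 3) :: arc c (j + 3) (a - 3)).
  rewrite /= last_arc -addnA subnKC; last by lia.
  by case: cyc.
apply: A_close.
- by rewrite /= size_arc; have -> : (a - 3).+3 = a by lia.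
- rewrite cons_uniq in_cons negb_or (off_arc a_gt0 cyc) // andbT cons_uniq.
  rewrite (off_arc a_gt0 cyc) // (arc_uniq a_gt0 cyc) /=; last by lia.
  by rewrite andbT; apply: contraTneq uw => ->; rewrite A_irr.
- rewrite /= A_sym uw u_adj ?(arc_path cyc) //.
  by rewrite addn3 same_sideS same_side_sym same_side2 same_side_sym.
Qed.

(** Neighbours of the cycle need up to [a] steps to see a whole side; from there membership in a
    side travels along [p], one edge per step. *)
Lemma side_reach t c p : is_cycle a (A t) c -> path (A t) (c 0) p ->
  side (t + a + size p) c 0 (last (c 0) p) \/
  side (t + a + size p) c 1 (last (c 0) p).
Proof.
elim/last_ind: p => [|p w IH] cyc.
  by move=> _ /=; apply: on_side (on_cycle_at a_gt0 cyc 0); apply: is_cycle_le cyc; lia.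
rewrite rcons_path last_rcons size_rcons addnS => /andP[/(IH cyc) {}IH].
set u := last _ p in IH *; set t' := t + a + size p in IH *.
have le : t <= t' by rewrite /t'; lia.
have cyc' := is_cycle_le le cyc.
move=> uw; have [w_on|w_off] := boolP (on c w).
  by apply: (on_side _ w_on); apply: is_cycle_le cyc'.
have [/(on_cycleP a_gt0 cyc)[i ui]|u_off] := boolP (on c u).
  apply: (@side01 _ _ i.+1); right; split=> // j; rewrite same_side2 => ss.
  apply: (@A_le (t + a)); first by rewrite /t'; lia.
  by apply: (spread cyc w_off) ss; rewrite A_sym -ui.
have [su|su] := IH; have := side_spread cyc' su u_off w_off (A_le le uw);
  exact: side01.
Qed.

(** Only two vertices off the cycle need a new edge. It closes the path [u], [c 1], ...,
    [c (a - 2)], [v] on [a] vertices; for even [a] the position [a - 2] is even, which is what [v]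
    requires. *)
Lemma side_join t c u v : is_cycle a (A t) c ->
    (forall i j, same_side a i.+1 j -> c i != c j -> A t (c i) (c j)) ->
  side t c 0 u -> side t c 1 v -> u != v -> A t.+1 u v.
Proof.
move=> cyc cbip [[i si ->]|[u_off u_adj]] [[j sj ->]|[v_off v_adj]] neq.
- apply: A_step; apply: cbip neq; apply: same_side_trans sj.
  by rewrite same_sideS same_side_sym.
- by apply: A_step; rewrite A_sym; apply: v_adj; rewrite same_side2.
- by apply: A_step; apply: u_adj.
have vc : A t v (c (1 + (a - 3))).
  apply: v_adj; rewrite /same_side; case: (boolP (odd a)) => //= a_even.
  by rewrite oddB //= addbT a_even.
have -> : v = last u (rcons (c 1 :: arc c 1 (a - 3)) v) by rewrite last_rcons.
apply: A_close.
- by rewrite /= size_rcons size_arc; have -> : (a - 3).+3 = a by lia.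
- rewrite cons_uniq mem_rcons in_cons negb_or neq (off_arc a_gt0 cyc) //=.
  have := off_arc a_gt0 cyc 1 (a - 3) v_off; rewrite in_cons negb_or => /andP[vc1 vna].
  have /= := @arc_uniq _ _ _ _ a_gt0 cyc 1 (a - 3).
  rewrite mem_rcons in_cons rcons_uniq negb_or vna eq_sym vc1 /=; apply; lia.
- rewrite rcons_path /= u_adj ?(arc_path cyc) ?last_arc 1?A_sym //.
  by rewrite /same_side eqxx orbT.
Qed.

End Cycle.

Lemma path_is_cycle t x p : path (A t) x p -> uniq (x :: p) ->
    A t (last x p) x ->
  is_cycle (size p).+1 (A t) (fun i => nth x (x :: p) (i %% (size p).+1)).
Proof.
move=> pp pu plast; split=> [i|i j|i]; first by rewrite modnDr.
  by move/eqP; rewrite nth_uniq //= ?ltn_pmod // => /eqP.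
have lt_i := ltn_pmod i (ltn0Sn (size p)).
have -> : i.+1 %% (size p).+1 = (i %% (size p).+1).+1 %% (size p).+1.
  by rewrite -[in LHS]addn1 -modnDml addn1.
have [lt|ge] := ltnP (i %% (size p).+1) (size p).
  by rewrite (@modn_small _.+1) //=; apply: (pathP x pp).
have -> : i %% (size p).+1 = size p by lia.
by rewrite modnn nth_last.
Qed.

(* The new path runs through [h - 2] vertices of either side, and uses [p q]
   to return to the side it started from. *)
Lemma other_side_complete t h (P Q : T -> Prop) (P0 Q0 : {set T}) p q u v :
    1 < h -> h.*2 \in ks ->
    (forall x, x \in P0 -> P x) -> (forall x, x \in Q0 -> Q x) ->
    (forall x, P x -> x \notin Q0) -> (forall x, Q x -> x \notin P0) ->
    h <= #|P0| -> h <= #|Q0| ->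
    (forall x y, P x -> Q y -> x != y -> A t x y) ->
    P p -> P q -> A t p q -> Q u -> Q v -> u != v ->
  A t.+1 u v.
Proof.
move=> h_gt1 h_ks P0P Q0Q PQ0 QP0 hP hQ PQ Pp Pq pq Qu Qv uv.
have [Pu|nPu] := EM (P u); first by apply: A_step; apply: PQ.
have [Pv|nPv] := EM (P v); first by apply: A_step; rewrite A_sym PQ // eq_sym.
have neP x y : P x -> ~ P y -> x != y by move=> Px; apply: contra_notN => /eqP <-.
have card2 (S : {set T}) x y : h <= #|S| -> h - 2 <= #|S :\ x :\ y|.
  by rewrite (cardsD1 x S) (cardsD1 y (S :\ x)); lia.
have [s1 [sz1 u1 sub1]] := subset_of_size (card2 P0 p q hP).
have [s2 [sz2 u2 sub2]] := subset_of_size (card2 Q0 u v hQ).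
have s1E x : x \in s1 -> [/\ x != p, x != q & x \in P0].
  by move/sub1; rewrite !inE => /and3P[].
have s2E x : x \in s2 -> [/\ x != u, x != v & x \in Q0].
  by move/sub2; rewrite !inE => /and3P[].
have s1P x : x \in s1 -> P x by case/s1E => _ _ /P0P.
have s2Q x : x \in s2 -> Q x by case/s2E => _ _ /Q0Q.
have s12 x y : x \in s1 -> y \in s2 -> x != y.
  by move=> xs ys; apply: contraNneq (PQ0 _ (s1P _ xs)) => ->; case/s2E: ys.
have pqne : p != q by apply: contraTneq pq => ->; rewrite A_irr.
have szs : size s1 = size s2 by rewrite sz1 sz2.
have mem_alt x : (x \in alternate s1 s2) = (x \in s1) || (x \in s2).
  by rewrite (perm_mem (perm_alternate szs)) mem_cat.
rewrite A_sym.
have -> : u = last v (alternate s1 s2 ++ [:: p; q; u]) by rewrite last_cat.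
apply: A_close.
- rewrite size_cat (perm_size (perm_alternate szs)) size_cat sz1 sz2 /=.
  by have -> : (h - 2 + (h - 2) + 3).+1 = h.*2 by lia.
- rewrite cons_uniq cat_uniq (perm_uniq (perm_alternate szs)) cat_uniq u1 u2.
  rewrite mem_cat mem_alt /= !inE !mem_alt !negb_or pqne /= !andbT.
  have n1 x : ~ P x -> x \notin s1 by move=> nPx; apply: contra_notN nPx => /s1P.
  have n2 x : P x -> x \notin s2 by move/PQ0; apply: contraNN => /s2E[].
  have [p1 q1] : p \notin s1 /\ q \notin s1.
    by split; apply/negP => /s1E[]; rewrite eqxx.
  have [u2' v2] : u \notin s2 /\ v \notin s2.
    by split; apply/negP => /s2E[]; rewrite eqxx.
  rewrite (n1 u) // (n1 v) // (n2 p) // (n2 q) // p1 q1 u2' v2 /=.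
  rewrite (eq_sym v p) (eq_sym v q) (eq_sym v u) uv !neP //= !andbT.
  by apply/hasPn => x xs2; apply/negP => /s12/(_ xs2); rewrite eqxx.
- rewrite cat_path alternate_path //=; last 2 first.
  + by move=> b /s1P Pb; rewrite A_sym PQ // neP.
  + by move=> b a' bs as2; apply: PQ; [apply: s1P | apply: s2Q | apply: s12].
  have := last_alternate v s1 s2; rewrite in_cons pq (PQ q u) ?neP // andbT => /predU1P[->|s2l].
    by rewrite A_sym PQ ?neP.
  rewrite A_sym PQ //; first exact: s2Q.
  by apply: contraTneq s2l => <-; apply/negP => /s2E[_ _]; apply/negP/PQ0.
Qed.

Lemma settled_or_new t (C : pred T) : settled t C \/
  exists x y, [/\ x \in C, y \in C, A t.+1 x y & ~~ A t x y].
Proof.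
have [|nn] := EM (exists x y, [/\ x \in C, y \in C, A t.+1 x y & ~~ A t x y]).
  by right.
left=> x y xC yC; apply/idP/idP; last exact: A_step.
by move=> new; apply: contrapT => /negP old; apply: nn; exists x, y.
Qed.

(** The pairs inside [S] that are adjacent form a growing subset of [setX S S], which has [#|S| ^ 2]
    elements. *)
Lemma settled_card t (C : pred T) (S : {set T}) : {subset C <= S} ->
  exists2 t', t <= t' <= t + #|S| ^ 2 & settled t' C.
Proof.
move=> CS.
pose F i := [set xy in setX S S | A (t + i) xy.1 xy.2].
have Fmono i : F i \subset F i.+1.
  by apply/subsetP => xy; rewrite !inE addnS => /andP[-> /A_step].
have FS i : F i \subset setX S S by apply/subsetP => xy; rewrite !inE => /andP[].
have [i le eqF] := nested_sets_stall Fmono FS.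
exists (t + i); first by rewrite leq_addr leq_add2l -mulnn -cardsX.
move=> x y /CS xS /CS yS.
by have /setP/(_ (x, y)) := eqF; rewrite !inE xS yS addnS.
Qed.

(** A first new edge closes a cycle of length [a] in the component. Either the component has no
    other vertices, or a vertex outside attaches to the cycle and all vertices fall into its two
    sides. *)
Lemma component_settles k D t x0 : {in ks, forall a, a <= k} ->
    (forall x y, connect (A t) x y ->
       exists p, [/\ path (A t) x p, last x p = y & size p <= D]) ->
  settled (t + k ^ 2 + k + k + D + 5) (connect (A t) x0).
Proof.
move=> ks_le diam; set C := connect (A t) x0; set M := _ + 5.
have [st|[x [y [xC yC new old]]]] := settled_or_new t C.
  by apply: settled_le st; rewrite leqnn /M -!addnA leq_addr.
have [p [p_ks pu pp py]] := A_new new old.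
set a := (size p).+1 in p_ks.
have a_ge3 : 2 < a by apply: (allP ks_ge3).
have a_gt0 : 0 < a by [].
have le_ak : a <= k by apply: ks_le.
have [c c0 cyc] : exists2 c, c 0 = x & is_cycle a (A t.+1) c.
  eexists; last apply: path_is_cycle => //; rewrite ?mod0n //.
    by apply: path_le pp.
  by rewrite py A_sym.
(* A component contained in the cycle has at most [k] vertices, which accounts for the term
   [k ^ 2]. *)
have [C_on|[w0 w0C w0_off]] : {subset C <= on_cycle a c} \/
    exists2 w, w \in C & ~~ on_cycle a c w.
  have [|nn] := EM (exists2 w, w \in C & ~~ on_cycle a c w); first by right.
  by left=> w wC; apply: contrapT => /negP w_off; apply: nn; exists w.
  have [t' /andP[le le'] st] : exists2 t',
      t <= t' <= t + #|[set c i | i : 'I_a]| ^ 2 & settled t' C.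
    apply: settled_card => w /C_on/existsP[i /eqP ->]; exact: imset_f.
  apply: settled_le st; rewrite le; apply: leq_trans le' _.
  have le_card : #|[set c i | i : 'I_a]| <= a.
    by apply: leq_trans (leq_imset_card _ _) _; rewrite card_ord.
  have : #|[set c i | i : 'I_a]| ^ 2 <= k ^ 2 by rewrite leq_exp2r // (leq_trans le_card).
  by clear; rewrite /M; lia.
have xw0 : connect (A t) x w0.
  by rewrite (connect_trans _ w0C) // A_connect_sym.
have [i0 [w [w_off w_adj]]] : exists i0 w, ~~ on_cycle a c w /\ A t.+1 w (c i0).
  have [p0 [p0p p0l _]] := diam _ _ xw0.
  have [||u [w [u_on w_off uw]]] := path_first_exit (P := on_cycle a c) p0p.
  - by rewrite -c0; apply: (on_cycle_at a_gt0 cyc).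
  - by rewrite p0l.
  have /(on_cycleP a_gt0 cyc)[i ui] := u_on.
  by exists i, w; split=> //; apply: A_step; rewrite A_sym -ui.
(* The cycle exists at time [t.+1]. By time [t2] its own sides are joined, which takes [a + a]
   steps, and every vertex has a side, which takes at most [a + D] steps. *)
pose t2 := t.+1 + a + a + D.
have le_tt2 : t < t2 by rewrite /t2 -!addnA leq_addr.
have le_t2M : t2.+4 <= M by clear -le_ak; rewrite /M /t2; lia.
have cyc_le s : t < s -> is_cycle a (A s) c by move=> lt; apply: is_cycle_le cyc.
have cyc2 : is_cycle a (A t2) c := cyc_le _ le_tt2.
have cbip i j : same_side a i.+1 j -> c i != c j -> A t2 (c i) (c j).
  move=> ss cij; apply: (@A_le (t.+1 + a + a)); first by rewrite leq_addr.
  exact: (cycle_bipartite p_ks cyc w_off w_adj).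
have sides z : z \in C -> side a t2 c 0 z \/ side a t2 c 1 z.
  move=> zC; have xz : connect (A t) x z by rewrite (connect_trans _ zC) // A_connect_sym.
  have [p0 [p0p <- szp]] := diam _ _ xz.
  have le : t.+1 + a + size p0 <= t2.
    by rewrite /t2 -[X in _ <= X]addnA leq_add // (leq_trans szp) // leq_addl.
  have := @side_reach _ p_ks t.+1 c p0 cyc; rewrite c0 => /(_ (path_le (leqnSn t) p0p)).
  by case=> /(side_le le); [left|right].
have join u v : side a t2 c 0 u -> side a t2 c 1 v -> u != v -> A t2.+1 u v.
  exact: (side_join p_ks cyc2 cbip).
have complete_settled s : (forall u v, u \in C -> v \in C -> u != v -> A s u v) -> settled s C.
  move=> cs u v uC vC; have [->|uv] := eqVneq u v; first by rewrite !A_irr.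
  by rewrite A_step cs.
(* For odd [a] the two sides coincide, so joining them makes the component complete. *)
have [a_odd|a_even] := boolP (odd a).
  apply: (@settled_le _ t2.+1); first by clear -le_tt2 le_t2M; lia.
  apply: complete_settled => u v uC vC; apply: join.
    have [//|] := sides _ uC; apply: side_eq; by rewrite /same_side a_odd.
  have [|//] := sides _ vC; apply: side_eq; by rewrite /same_side a_odd.
(* For even [a], an edge that is still new at this point lies inside one side, because the sides are
   already joined to each other. *)
have [st|[u [v [uC vC uv uv_old]]]] := settled_or_new t2.+1 C.
  by apply: settled_le st; clear -le_tt2 le_t2M; lia.
pose h := a./2.
have aE : a = h.*2 by rewrite halfK (negbTE a_even) subn0.
have h_gt1 : 1 < h by clear -aE a_ge3; lia.
pose cs b := [set c (m.*2 + b) | m : 'I_h].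
have side_on b i : side a t2 c b (c i) -> odd i = odd b.
  case=> [[j ss /(cycle_modP cyc)]|[]]; last by rewrite (on_cycle_at a_gt0 cyc).
  move=> eq; rewrite -(odd_mod i (negbTE a_even)) eq odd_mod ?(negbTE a_even) //.
  by move: ss; rewrite /same_side (negbTE a_even) => /eqP.
have cs_side b z : z \in cs b -> side a t2 c b z.
  case/imsetP=> m _ ->; left; exists (m.*2 + b) => //.
  by rewrite /same_side oddD odd_double eqxx orbT.
have side_cs b b' z : odd b' = ~~ odd b -> side a t2 c b z -> z \notin cs b'.
  move=> bb' sz; apply/imsetP => -[m _ zE]; rewrite zE in sz.
  by move/side_on: sz; rewrite oddD odd_double bb'; case: (odd b).
have cs_card b : b < 2 -> h <= #|cs b|.
  move=> lt_b; rewrite card_imset ?card_ord // => m m' /(cycle_modP cyc)/eqP.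
  rewrite eqn_modDr !modn_small ?aE ?ltn_double // => /eqP/double_inj; exact: val_inj.
have side_close b b' p1 q1 s : (b, b') = (0, 1) \/ (b, b') = (1, 0) -> t2 < s ->
    side a t2 c b p1 -> side a t2 c b q1 -> A s p1 q1 ->
    forall z z', side a t2 c b' z -> side a t2 c b' z' -> z != z' -> A s.+1 z z'.
  move=> bb' lt_s sp sq pq z z' sz sz' zz'.
  have jn g g' : side a t2 c b g -> side a t2 c b' g' -> g != g' -> A s g g'.
    move=> sy sy' ne; apply: (A_le lt_s).
    case: bb' sy sy' => -[-> ->] sy sy'; first exact: join.
    by rewrite A_sym; apply: join; rewrite // eq_sym.
  have obb' : odd b' = ~~ odd b by case: bb' => -[-> ->].
  apply: (@other_side_complete s h (side a t2 c b) (side a t2 c b') (cs b) (cs b') p1 q1) => //.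
  - by rewrite -aE.
  - exact: cs_side.
  - exact: cs_side.
  - by move=> g; apply: side_cs.
  - by move=> g; apply: side_cs; rewrite obb' negbK.
  - by apply: cs_card; case: bb' => -[-> _].
  - by apply: cs_card; case: bb' => -[_ ->].
have neq13 b : c b.+2 != c b by rewrite eq_sym (cycle_neq a_gt0 cyc) //; clear -a_ge3; lia.
have [b [b' [bb' [su sv]]]] : exists b b', ((b, b') = (0, 1) \/ (b, b') = (1, 0)) /\
    side a t2 c b u /\ side a t2 c b v.
  have uvne : u != v by apply: contraTneq uv => ->; rewrite A_irr.
  have [su|su] := sides _ uC; have [sv|sv] := sides _ vC.
  - by exists 0, 1; split; [left|].
  - by rewrite join in uv_old.
  - by rewrite A_sym join 1?eq_sym in uv_old.
  - by exists 1, 0; split; [right|].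
(* The new edge inside side [b] completes side [b'] in one step; an edge of that side then completes
   side [b] in one more. *)
have Q1 := side_close b b' u v t2.+2 bb' (leqnSn _) su sv uv.
have c_side i : side a t2 c i (c i) by left; exists i; rewrite // /same_side eqxx orbT.
have c_side2 i : side a t2 c i (c i.+2).
  by left; exists i.+2; rewrite // same_side_sym same_side2 /same_side eqxx orbT.
have bb'_sym : (b', b) = (0, 1) \/ (b', b) = (1, 0) by case: bb' => -[-> ->]; [right|left].
have P1 := side_close b' b (c b'.+2) (c b') t2.+3 bb'_sym (leqW (leqnSn _))
  (c_side2 b') (c_side b') (Q1 _ _ (c_side2 b') (c_side b') (neq13 b')).
apply: (@settled_le _ t2.+4); first by rewrite le_t2M andbT; clear -le_tt2; lia.
apply: complete_settled => z z' zC z'C zz'.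
have le1 : t2.+1 <= t2.+4 by clear; lia.
have Qw : forall z z', side a t2 c b' z -> side a t2 c b' z' -> z != z' -> A t2.+4 z z'.
  by move=> ? ? h1 h2 h3; apply: A_step; apply: Q1.
case: bb' P1 Qw => -[-> ->] P1 Qw.
all: have [sz|sz] := sides _ zC; have [sz'|sz'] := sides _ z'C;
  first [ exact: P1 | exact: Qw | exact: (A_le le1 (join _ _ sz sz' zz'))
        | by rewrite A_sym (A_le le1) // join // eq_sym ].
Qed.

(** Each full piece of [q] edges is replaced by its chord, and fewer than [q] edges are left over at
    the end. *)
Lemma path_contract t q x p : q.+1 \in ks -> path (A t) x p -> uniq (x :: p) ->
  exists p', [/\ path (A t.+1) x p', last x p' = last x p
    & size p' <= size p %/ q + q.-1].
Proof.
move=> q_ks; have q_gt1 : 1 < q by have := allP ks_ge3 _ q_ks.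
have [n] := ubnP (size p); elim: n x p => // n IH x p; rewrite ltnS => le_n pp pu.
have [lt|ge] := ltnP (size p) q.
  exists p; split=> //; first by apply: path_le pp.
  by rewrite divn_small //; lia.
have [p1 [p2 [pE sz1]]] : exists p1 p2, p = p1 ++ p2 /\ size p1 = q.
  by exists (take q p), (drop q p); rewrite cat_take_drop size_takel.
move: pp pu le_n; rewrite {ge}pE.
rewrite cat_path -cat_cons cat_uniq => /andP[pp1 pp2] /and3P[u1 dis u2].
rewrite size_cat sz1 => le_n.
have e1 : A t.+1 x (last x p1) by apply: A_close; rewrite ?sz1.
have [|//||p' [pp' lp' szp']] := IH (last x p1) p2.
- by clear -le_n q_gt1; lia.
- rewrite /= u2 andbT; apply: contraNN dis => l2; apply/hasP.
  by exists (last x p1); rewrite // mem_last.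
exists (last x p1 :: p'); split; rewrite /= ?e1 // ?lp' ?last_cat //.
by rewrite divnDl ?dvdnn // divnn (ltnW q_gt1).
Qed.

Lemma short_paths j q t x y : q.+1 \in ks -> #|T| <= q ^ j ->
    connect (A t) x y ->
  exists p, [/\ path (A (t + j)) x p, last x p = y & size p <= q.*2.+1].
Proof.
move=> q_ks le_T; have q_gt1 : 1 < q by have := allP ks_ge3 _ q_ks.
(* The summand [q.*2] absorbs the leftovers of all steps: dividing it by [q] and adding [q.-1] gives
   [q.+1], which is at most [q.*2]. *)
suff main i : i <= j -> connect (A t) x y -> exists p,
    [/\ path (A (t + i)) x p, uniq (x :: p), last x p = y & size p <= q ^ (j - i) + q.*2].
  move/(main _ (leqnn j)) => [p [pp _ lp]]; rewrite subnn expn0 add1n => szp.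
  by exists p.
elim: i => [|i IH] le_i cxy.
  have /connectP[p0 pp0 ->] := cxy.
  have [p pp pu _] := shortenP pp0.
  exists p; split=> //; rewrite ?addn0 // subn0.
  have := max_card (mem (x :: p)); rewrite (card_uniqP pu) => /ltnW le_p.
  exact: leq_trans le_p (leq_trans le_T (leq_addr _ _)).
have [p [pp pu lp szp]] := IH (ltnW le_i) cxy.
have [p' [pp' lp' szp']] := path_contract q_ks pp pu.
have : last x p' = y by rewrite lp'.
have [p2 pp2 u2 sub2] := shortenP pp' => l2.
exists p2; split=> //; first by rewrite addnS.
have szp2 : size p2 <= size p' by apply: uniq_leq_size => //; case/andP: u2.
apply: leq_trans szp2 (leq_trans szp' _).
have : size p %/ q <= (q ^ (j - i) + q.*2) %/ q by apply: leq_div2r.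
have -> : j - i = (j - i.+1).+1 by clear -le_i; lia.
rewrite expnS -mul2n [2 * q]mulnC -mulnDr mulKn; clear -q_gt1; lia.
Qed.

(** After [j] steps [component_settles] applies with [k = q.+1] and [D = q.*2.+1]; its summands
    [k + k + D + 5] add up to [q.*2.*2 + 8]. *)
Lemma free_process_settles j q t : q.+1 \in ks ->
    {in ks, forall a, a <= q.+1} -> #|T| <= q ^ j ->
  forall x y, A (t + j + q.+1 ^ 2 + q.*2.*2 + 8).+1 x y
            = A (t + j + q.+1 ^ 2 + q.*2.*2 + 8) x y.
Proof.
move=> q_ks ks_le le_T x y; set M := (_ + 8).
have diam u v : connect (A (t + j)) u v -> exists p,
    [/\ path (A (t + j)) u p, last u p = v & size p <= q.*2.+1].
  move=> /connectP[p pp ->]; apply: short_paths => //.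
  elim: p u pp => //= w p IH u /andP[uw /IH]; apply: connect_trans.
  by apply: A_connect uw; rewrite leq_addr.
have st z : settled M (connect (A (t + j)) z).
  apply: settled_le (@component_settles _ _ _ z ks_le diam).
  by clear; rewrite /M; lia.
apply/idP/idP; last exact: A_step.
move=> Axy; rewrite -(st x) //; first exact: connect0.
by apply: A_connect Axy; rewrite /M; lia.
Qed.

End FreeProcess.

(** * Exchangeable branches in graphs without long paths *)

Section ComponentSwap.

Variables (T : finType) (x0 : T) (D E : {set T}).
Hypotheses (cardDE : #|D| = #|E|) (disDE : [disjoint D & E]).

(** The exchange matches elements by their position in the enumerations of [D] and [E], the same
    positions that [component_type] compares. *)
Definition swap_sets x :=
  if x \in D then nth x0 (enum E) (index x (enum D))
  else if x \in E then nth x0 (enum D) (index x (enum E)) else x.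

Let transfer (F G : {set T}) x : #|F| = #|G| -> x \in F ->
  nth x0 (enum G) (index x (enum F)) \in G /\
  nth x0 (enum F) (index (nth x0 (enum G) (index x (enum F))) (enum G)) = x.
Proof.
move=> eFG xF; have lt : index x (enum F) < size (enum G).
  by rewrite -cardE -eFG cardE index_mem mem_enum.
split; first by rewrite -mem_enum mem_nth.
by rewrite index_uniq ?enum_uniq // nth_index // mem_enum.
Qed.

Lemma swap_sets_l x : x \in D -> swap_sets x \in E.
Proof. by move=> xD; rewrite /swap_sets xD; case: (transfer cardDE xD). Qed.

Lemma swap_sets_r x : x \in E -> swap_sets x \in D.
Proof.
move=> xE; rewrite /swap_sets (disjointFl disDE xE) xE.
by case: (transfer (esym cardDE) xE).
Qed.

Lemma swap_setsK : involutive swap_sets.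
Proof.
move=> x; have [xD|xD] := boolP (x \in D).
  rewrite {1}/swap_sets (disjointFl disDE (swap_sets_l xD)) (swap_sets_l xD).
  by rewrite /swap_sets xD; case: (transfer cardDE xD).
have [xE|xE] := boolP (x \in E).
  rewrite {1}/swap_sets (swap_sets_r xE) /swap_sets (negbTE xD) xE.
  by case: (transfer (esym cardDE) xE).
by rewrite /swap_sets (negbTE xD) (negbTE xE) (negbTE xD) (negbTE xE).
Qed.

Lemma swap_sets_id x : x \notin D -> x \notin E -> swap_sets x = x.
Proof. by rewrite /swap_sets => /negbTE -> /negbTE ->. Qed.

End ComponentSwap.

Definition restrict (T : finType) (r : rel T) (S : {set T}) : rel T :=
  fun x y => [&& x \in S, y \in S & r x y].
Arguments restrict {T} r S x y /.

(** A substitute for bounded tree-depth that suits induction on [d]: deleting the root [v] of a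
    component leaves pieces rooted at neighbours of [v], with depth one less. *)
Definition rooted_depth (T : finType) (r : rel T) (d : nat) (S : {set T}) :=
  forall x, x \in S -> exists v, [/\ v \in S, connect (restrict r S) v x &
    forall p, path (restrict r S) v p -> uniq (v :: p) -> size p < d].

(* [sigma j] exchanges [B] with its [j]-th copy, which is the image of [B], and
   fixes everything else; the copies are pairwise disjoint by [swap_inj]. *)
Record branch_swaps (T : finType) (C : eqType) (r : rel T) (col : T -> C)
    (S : {set T}) (m : nat) (B : {set T}) (sigma : 'I_m -> T -> T) : Prop :=
  BranchSwaps {
    branch_neq0 : B != set0;
    branch_sub : B \subset S;
    swap_sub : forall j x, x \in B -> sigma j x \in S;
    swap_out : forall j x, x \in B -> sigma j x \notin B;
    swap_inj : forall i j x, sigma i x \in B -> sigma j x \in B -> i = j;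
    swapK : forall j, involutive (sigma j);
    swap_id : forall j x, x \notin B -> sigma j x \notin B -> sigma j x = x;
    swap_rel : forall j, {in S &, forall x y, r (sigma j x) (sigma j y) = r x y};
    swap_col : forall j, {in S, forall x, col (sigma j x) = col x} }.

Section Swaps.

Variables (T : finType) (C : eqType) (r : rel T) (col : T -> C) (S : {set T}).
Variables (m : nat) (B : {set T}) (sigma : 'I_m -> T -> T).
Hypothesis sw : branch_swaps r col S B sigma.

Lemma swap_stable j x : x \in S -> sigma j x \in S.
Proof.
move=> xS; have [xB|xB] := boolP (x \in B); first exact: (swap_sub sw).
have [sB|sB] := boolP (sigma j x \in B); first by apply: (subsetP (branch_sub sw)).
by rewrite (swap_id sw).
Qed.

Lemma swap_fix j x : x \notin S -> sigma j x = x.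
Proof.
move=> xS; apply: (swap_id sw).
  by apply: contra xS; apply/subsetP/(branch_sub sw).
by apply: contra xS => /(swap_sub sw j); rewrite (swapK sw).
Qed.

End Swaps.

(** * Components and their coloured isomorphism types *)

Section Components.

Variables (T : finType) (r : rel T) (S : {set T}).
Hypothesis r_sym : symmetric r.

Local Notation rS := (restrict r S).

Lemma restrict_sym : symmetric rS.
Proof. by move=> x y; rewrite /= r_sym andbCA. Qed.

Let cS : connect_sym rS := sym_connect_sym restrict_sym.

Lemma restrict_last x p : x \in S -> path rS x p -> last x p \in S.
Proof. by elim: p x => //= z p IHp x xS /andP[/and3P[_ zS _]]; apply: IHp. Qed.

Definition component x := [set y | connect rS x y].

Lemma component_sub x : x \in S -> component x \subset S.
Proof.
move=> xS; apply/subsetP => y; rewrite inE => /connectP[p pp ->].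
exact: restrict_last pp.
Qed.

Lemma component_eq x y : y \in component x -> component y = component x.
Proof.
rewrite inE => xy; apply/setP => z; rewrite !inE.
by apply/idP/idP; apply: connect_trans; rewrite // cS.
Qed.

Lemma component_rel x y z : x \in S -> y \in component x -> z \in S ->
  z \notin component x -> r y z = false.
Proof.
move=> xS yx zS; apply: contraNF => yz; have yS := subsetP (component_sub xS) _ yx.
move: yx; rewrite !inE => /connect_trans; apply; apply: connect1.
by rewrite /= yS zS.
Qed.

Definition components := [set component x | x in S].

Lemma cover_components : cover components = S.
Proof.
apply/setP => y; apply/bigcupP/idP => [[_ /imsetP[x xS ->]]|yS].
  by apply/subsetP/component_sub.
by exists (component y); rewrite ?imset_f // inE connect0.
Qed.

Variables (C : finType) (col : T -> C) (s : nat) (x0 : T).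

(** The coloured graph on [D], read along its enumeration, as an element of a fixed finite type.
    Positions beyond [#|D|] read the default [x0]; this can only make the types finer. *)
Definition component_type (D : {set T}) :
    'I_s.+1 * {ffun 'I_s * 'I_s -> bool} * {ffun 'I_s -> C} :=
  (inord #|D|,
   [ffun ij : 'I_s * 'I_s => r (nth x0 (enum D) ij.1) (nth x0 (enum D) ij.2)],
   [ffun i : 'I_s => col (nth x0 (enum D) i)]).

Hypothesis small : forall D, D \in components -> #|D| <= s.

(** Distinct components are disjoint and have no edges to the rest of [S], so adjacency has to be
    compared only inside [D] and inside [E], where the types agree. *)
Lemma swap_sets_automorphism D E : D \in components -> E \in components ->
    D != E -> component_type D = component_type E ->
  [/\ #|D| = #|E|, [disjoint D & E],
      {in S &, forall x y, r (swap_sets x0 D E x) (swap_sets x0 D E y) = r x y}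
    & {in S, forall x, col (swap_sets x0 D E x) = col x}].
Proof.
move=> compD compE neDE [eq_card eq_r eq_col].
have cardDE : #|D| = #|E|.
  by move/(congr1 (@nat_of_ord _)): eq_card; rewrite !inordK // ltnS small.
have disDE : [disjoint D & E].
  have /imsetP[x xS xD] := compD; have /imsetP[y yS yE] := compE.
  apply/pred0Pn => -[z /andP[/= zD zE]]; case/eqP: neDE.
  by rewrite xD yE in zD zE *; rewrite -(component_eq zD) (component_eq zE).
have {eq_r} eq_r i j : i < #|D| -> j < #|D| ->
    r (nth x0 (enum D) i) (nth x0 (enum D) j) = r (nth x0 (enum E) i) (nth x0 (enum E) j).
  move=> iD jD; have is_ := leq_trans iD (small compD); have js := leq_trans jD (small compD).
  by move/ffunP/(_ (Ordinal is_, Ordinal js)): eq_r; rewrite !ffunE.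
have {eq_col} eq_col i : i < #|D| -> col (nth x0 (enum D) i) = col (nth x0 (enum E) i).
  move=> iD; have is_ := leq_trans iD (small compD).
  by move/ffunP/(_ (Ordinal is_)): eq_col; rewrite !ffunE.
have idx (F : {set T}) x : x \in F -> index x (enum F) < #|F|.
  by move=> xF; rewrite cardE index_mem mem_enum.
have nthi (F : {set T}) x : x \in F -> nth x0 (enum F) (index x (enum F)) = x.
  by move=> xF; rewrite nth_index // mem_enum.
have sepD x y : x \in D -> y \in S -> y \notin D -> r x y = false.
  by have /imsetP[z zS ->] := compD; apply: component_rel.
have sepE x y : x \in E -> y \in S -> y \notin E -> r x y = false.
  by have /imsetP[z zS ->] := compE; apply: component_rel.
have subD : D \subset S by have /imsetP[z zS ->] := compD; apply: component_sub.
have subE : E \subset S by have /imsetP[z zS ->] := compE; apply: component_sub.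
have swl x : x \in D -> swap_sets x0 D E x \in E by apply: swap_sets_l.
have swr x : x \in E -> swap_sets x0 D E x \in D by apply: swap_sets_r.
have nD x : x \in E -> x \notin D by move=> xE; rewrite (disjointFl disDE).
have nE x : x \in D -> x \notin E by move=> xD; rewrite (disjointFr disDE).
have inD := subsetP subD; have inE_ := subsetP subE.
split=> //.
- have half x y : x \in S -> y \in S -> (x \in D) || (x \in E) ->
      r (swap_sets x0 D E x) (swap_sets x0 D E y) = r x y.
    move=> xS yS /orP[xD|xE].
    + have [yD|nyD] := boolP (y \in D).
        rewrite /swap_sets xD yD -eq_r ?idx ?nthi //.
      have [yE|nyE] := boolP (y \in E).
        rewrite (sepD x) ?nD //; apply: sepE; [exact: swl | exact/inD/swr | exact/nE/swr].
      by rewrite (swap_sets_id x0 nyD nyE) (sepE (swap_sets x0 D E x)) ?swl // sepD.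
    + have [yE|nyE] := boolP (y \in E).
        rewrite /swap_sets (negbTE (nD _ xE)) (negbTE (nD _ yE)) xE yE.
        by rewrite eq_r ?cardDE ?idx ?nthi.
      have [yD|nyD] := boolP (y \in D).
        rewrite (sepE x) ?nE //; apply: sepD; [exact: swr | exact/inE_/swl | exact/nD/swl].
      by rewrite (swap_sets_id x0 nyD nyE) (sepD (swap_sets x0 D E x)) ?swr // sepE.
  move=> x y xS yS; have [xin|] := boolP ((x \in D) || (x \in E)); first exact: half.
  rewrite negb_or => /andP[xD xE].
  have [yin|] := boolP ((y \in D) || (y \in E)).
    by rewrite r_sym half // r_sym.
  by rewrite negb_or => /andP[yD yE]; rewrite !swap_sets_id.
- move=> x xS; rewrite /swap_sets; case: ifP => [xD|_].
    by rewrite -eq_col ?idx ?nthi.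
  by case: ifP => // xE; rewrite eq_col ?cardDE ?idx ?nthi.
Qed.

Lemma many_components_swaps m :
    s * (m * #|{: 'I_s.+1 * {ffun 'I_s * 'I_s -> bool} * {ffun 'I_s -> C}}|) < #|S| ->
  exists B (sigma : 'I_m -> T -> T), branch_swaps r col S B sigma.
Proof.
set types := #|{: _ * _}|; move=> large.
have many : m * types < #|components|.
  rewrite ltnNge; apply/negP => few; move: large; apply/negP.
  rewrite -leqNgt. rewrite -{1}cover_components.
  apply: leq_trans (leq_card_cover _) _.
  apply: (@leq_trans (\sum_(D in components) s)); first exact: leq_sum.
  by rewrite sum_nat_const mulnC leq_mul2l few orbT.
(* Pigeonhole: some type is shared by at least [m.+1] components. The first of them serves as [B],
   the next [m] as its copies. *)
have [ty lt_ty] : exists ty, m < #|[set D in components | component_type D == ty]|.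
  apply/existsP; apply: contraLR many; rewrite negb_exists -leqNgt => /forallP few.
  have -> : #|components| = \sum_ty #|[set D in components | component_type D == ty]|.
    rewrite -sum1_card (partition_big component_type predT) //=.
    by apply: eq_bigr => ty _; rewrite -sum1_card; apply: eq_bigl => D; rewrite inE.
  rewrite mulnC -sum_nat_const; apply: leq_sum => ty _; by rewrite leqNgt.
set Q := [set D in components | _] in lt_ty.
pose Dn i := nth set0 (enum Q) i.
have DnQ i : i <= m -> Dn i \in Q.
  by move=> le; rewrite -mem_enum mem_nth // -cardE (leq_ltn_trans le).
have Dn_comp i : i <= m -> Dn i \in components by move/DnQ; rewrite inE => /andP[].
have Dn_inj i j : i <= m -> j <= m -> Dn i = Dn j -> i = j.
  move=> li lj /eqP; rewrite nth_uniq ?enum_uniq -?cardE ?(leq_ltn_trans _ lt_ty) //.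
  by move/eqP.
have Dn_type i j : i <= m -> j <= m -> component_type (Dn i) = component_type (Dn j).
  by move=> /DnQ + /DnQ; rewrite !inE => /andP[_ /eqP ->] /andP[_ /eqP ->].
have Dn_dis i j : i <= m -> j <= m -> i != j ->
    [/\ #|Dn i| = #|Dn j|, [disjoint Dn i & Dn j],
    {in S &, forall x y,
       r (swap_sets x0 (Dn i) (Dn j) x) (swap_sets x0 (Dn i) (Dn j) y) = r x y}
    & {in S, forall x, col (swap_sets x0 (Dn i) (Dn j) x) = col x}].
  move=> li lj ne; apply: swap_sets_automorphism; rewrite ?Dn_comp //; last exact: Dn_type.
  by apply: contraNneq ne => /(Dn_inj _ _ li lj) ->.
exists (Dn 0), (fun j => swap_sets x0 (Dn 0) (Dn j.+1)).
have dis0 (j : 'I_m) := Dn_dis 0 j.+1 (leq0n _) (ltn_ord j) isT.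
have compS i : i <= m -> Dn i \subset S.
  by move=> /Dn_comp/imsetP[x xS ->]; apply: component_sub.
have back (j : 'I_m) x : swap_sets x0 (Dn 0) (Dn j.+1) x \in Dn 0 -> x \in Dn j.+1.
  have [cj dj _ _] := dis0 j => /(swap_sets_l x0 cj).
  by rewrite swap_setsK.
split.
- have /imsetP[x xS ->] := Dn_comp 0 (leq0n _).
  by apply/set0Pn; exists x; rewrite inE connect0.
- exact: compS.
- move=> j x xD; have [cj dj _ _] := dis0 j.
  by apply: (subsetP (compS j.+1 (ltn_ord j))); apply: swap_sets_l.
- move=> j x xD; have [cj dj _ _] := dis0 j.
  by rewrite (disjointFl dj) // swap_sets_l.
- move=> i j x /back xi /back xj; apply/val_inj/eqP; apply: contraTT xj => ne.
  by have [_ dij _ _] := Dn_dis i.+1 j.+1 (ltn_ord i) (ltn_ord j) ne; rewrite (disjointFr dij).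
- by move=> j; have [cj dj _ _] := dis0 j; apply: swap_setsK.
- move=> j x x0' sx; have [cj dj _ _] := dis0 j; apply: swap_sets_id => //.
  by apply: contra sx => xj; apply: swap_sets_r.
- by move=> j; have [] := dis0 j.
- by move=> j; have [] := dis0 j.
Qed.

End Components.

(** Induction on [d]. If all components are small, many of them share a type. Otherwise the root of
    a large component is deleted, and the induction hypothesis is applied to the rest of that
    component. *)
Lemma branch_swaps_exist d (C : finType) m : exists N, forall (T : finType)
    (r : rel T) (col : T -> C) (S : {set T}),
    symmetric r -> rooted_depth r d S -> N < #|S| ->
  exists B (sigma : 'I_m -> T -> T), branch_swaps r col S B sigma.
Proof.
elim: d C => [|d IH] C.
  exists 0 => T r col S _ rooted /card_gt0P[x /rooted[v [_ _ /(_ [::] isT isT)]]].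
  by rewrite ltn0.
have [N' HN'] := IH (C * bool)%type.
pose s := N'.+1.
exists (s * (m * #|{: 'I_s.+1 * {ffun 'I_s * 'I_s -> bool} * {ffun 'I_s -> C}}|)).
move=> T r col S r_sym rooted large.
have [x0 x0S] : exists x0, x0 \in S by apply/card_gt0P; apply: leq_ltn_trans large.
have [all_small|[x xS x_large]] : (forall D, D \in components r S -> #|D| <= s) \/
    exists2 x, x \in S & s < #|component r S x|.
  have [|nn] := EM (exists2 x, x \in S & s < #|component r S x|); first by right.
  left=> _ /imsetP[x xS ->]; rewrite leqNgt; apply/negP => lt; apply: nn.
  by exists x.
  exact: (many_components_swaps r_sym col x0 all_small large).
have [v [vS cvx depth]] := rooted x xS.
have vD : component r S v = component r S x by rewrite -(component_eq r_sym (y := x)) ?inE.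
set D := component r S x in x_large vD.
have DS : D \subset S by apply: component_sub.
pose S' := D :\ v.
have S'P y : (y \in S') = (y != v) && connect (restrict r S) v y.
  by rewrite in_setD1 -vD inE.
have S'S : S' \subset S by apply: subset_trans (subsetDl _ _) DS.
have restr : subrel (restrict r S') (restrict r S).
  by move=> y z /and3P[yS zS ryz]; rewrite /= ryz !(subsetP S'S).
(* The extra colour records adjacency to the deleted root [v], so that exchanges inside [S'] also
   respect the edges at [v]. *)
have [|| B [sigma sw]] := HN' T r (fun y => (col y, r v y)) S' r_sym.
- move=> y; rewrite S'P => /andP[yv /connectP[p0 pp0 ylast]].
  move: ylast yv; have [p pp pu _] := shortenP pp0.
  case: p pp pu => [_ _ -> /eqP //|w p vwp pu ylast yv].
  have /andP[vw wp] := vwp.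
  have in_path z : z \in w :: p -> z \in S'.
    move=> zp; rewrite S'P; apply/andP; split.
      by apply: contraTneq zp => ->; case/andP: pu.
    by apply: (path_connect vwp); rewrite in_cons zp orbT.
  exists w; split; first by apply: in_path; rewrite mem_head.
    have wp' : path (restrict r S') w p.
      apply: (sub_in_path (P := mem S')) wp; last by apply/allP.
      by move=> a b aS bS /and3P[_ _ rab]; apply/and3P; split.
    by rewrite ylast; apply/connectP; exists p.
  (* Prefixing the edge from [v] to [w] turns a path from [w] into one from [v] with one edge more,
     so the bound drops by one. *)
  move=> q qp qu; apply: (depth (w :: q)).
    by rewrite [path _ _ _]/= -[X in X && _]/(restrict r S v w) vw (sub_path restr).
  rewrite cons_uniq qu andbT; apply/negP => vwq.
  have /(path_connect qp)/connectP[q0 q0p vq] := vwq.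
  have : v \in S' by rewrite vq; apply: restrict_last q0p; apply: in_path; rewrite mem_head.
  by rewrite S'P eqxx.
- have vD' : v \in D by rewrite -vD inE connect0.
  by move: x_large; rewrite (cardsD1 v D) vD'.
exists B, sigma; have [neq0 sub ssub sout sinj sK sid srel scol] := sw.
have stab := swap_stable sw; have fix_ := swap_fix sw.
split=> //.
- exact: subset_trans sub S'S.
- by move=> j y yB; apply: (subsetP S'S); apply: ssub.
- have half j y z : y \in S' -> z \in S -> r (sigma j y) (sigma j z) = r y z.
    move=> yS' zS; have [zS'|zS'] := boolP (z \in S'); first exact: srel.
    rewrite (fix_ j z zS'); have [->|zv] := eqVneq z v.
      by rewrite ![r _ v]r_sym; case: (scol j y yS').
    have zD : z \notin D by apply: contra zS'; rewrite in_setD1 zv.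
    have S'D : S' \subset D by apply: subsetDl.
    by rewrite !(component_rel xS _ zS zD) //; apply: (subsetP S'D); rewrite ?stab.
  move=> j y z yS zS; have [yS'|yS'] := boolP (y \in S'); first exact: half.
  have [zS'|zS'] := boolP (z \in S'); first by rewrite r_sym half // r_sym.
  by rewrite !fix_.
- move=> j y yS; have [yS'|yS'] := boolP (y \in S'); last by rewrite fix_.
  by case: (scol j y yS').
Qed.

(** * The bootstrap process of an arbitrary pattern *)

Definition adj (T : finType) (G : {set {set T}}) : rel T :=
  fun x y => [set x; y] \in G.
Arguments adj {T} G x y /.

Section Pattern.

Variables (U : finType) (H : {set {set U}}).

Section Process.

Variable T : finType.
Implicit Types (G : {set {set T}}) (e : {set T}).

Local Notation step := (@bootstrap_step U H T).
Local Notation process := (@bootstrap_process U H T).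

(** Copies in [G] persist in [e |: G], so their number increases exactly when some copy in [e |: G]
    is not contained in [G], and such a copy uses [e]. *)
Lemma bootstrap_stepP G e : reflect (e \in G \/ #|e| = 2 /\
    exists f : U -> T, [/\ injective f, exists2 h, h \in H & e = f @: h
                         & forall h, h \in H -> f @: h \in e |: G])
  (e \in step G).
Proof.
have sub : copies H G \subset copies H (e |: G).
  apply/subsetP => S; rewrite !inE => /andP[SG ->]; rewrite andbT.
  exact: subset_trans SG (subsetU1 _ _).
rewrite !inE; apply: (iffP orP) => [[|/andP[/eqP e2 more]]|[|[e2 [f [f_inj [h0 h0H eE] fH]]]]].
- by left.
- right; split=> //; have /subsetPn[S] : ~~ (copies H (e |: G) \subset copies H G).
    by apply: contraL more => /subset_leq_card; rewrite -leqNgt.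
  rewrite !inE => /andP[SG iso]; rewrite iso andbT => nSG.
  have eS : e \in S.2.
    have /subsetPn[e' e'S nG] := nSG.
    by have := subsetP SG _ e'S; rewrite !inE (negbTE nG) orbF => /eqP <-.
  have /existsP[f /and3P[/injectiveP f_inj _ /eqP fS]] := iso.
  exists f; split=> //.
    by have := eS; rewrite -fS => /imsetP[h hH ->]; exists h.
  by move=> h hH; apply: (subsetP SG); rewrite -fS imset_f.
- by left.
have [eG|eG] := boolP (e \in G); [by left | right].
rewrite e2 eqxx /=; apply: proper_card; rewrite properE sub /=.
apply/subsetPn; pose g := finfun f; have gE : g =1 f by move=> u; rewrite ffunE.
have gI (h : {set U}) : g @: h = f @: h by apply: eq_imset.
exists (g @: [set: U], [set g @: h | h : {set U} in H]); rewrite !inE /=.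
  apply/andP; split.
    by apply/subsetP => _ /imsetP[h hH ->]; rewrite gI; apply: fH.
  apply/existsP; exists g; rewrite !eqxx !andbT.
  by apply/injectiveP => u v; rewrite !gE; apply: f_inj.
apply/nandP; left; apply/subsetPn; exists e => //.
by rewrite eE -gI imset_f.
Qed.

Lemma step_sub G : G \subset step G.
Proof. by apply/subsetP => e eG; apply/bootstrap_stepP; left. Qed.

Lemma step_mono G G' : G \subset G' -> step G \subset step G'.
Proof.
move=> /subsetP sub; apply/subsetP => e /bootstrap_stepP[/sub eG'|[e2 [f [fi fh fH]]]].
  by apply/bootstrap_stepP; left.
apply/bootstrap_stepP; right; split=> //; exists f; split=> // h hH.
by have := fH h hH; rewrite !inE => /orP[->//|/sub ->]; rewrite orbT.
Qed.

Lemma processS G t : process G t.+1 = step (process G t).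
Proof. by []. Qed.

Lemma process_le G t t' : t <= t' -> process G t \subset process G t'.
Proof.
elim: t' => [|t' IH]; first by rewrite leqn0 => /eqP ->.
rewrite leq_eqVlt => /predU1P[-> //|/IH le]; exact: subset_trans le (step_sub _).
Qed.

Lemma process_mono G G' t : G \subset G' -> process G t \subset process G' t.
Proof. by move=> sub; elim: t => // t IH; apply: step_mono. Qed.

Lemma process_stall G t t' : t <= t' -> process G t = process G t.+1 ->
  process G t' = process G t'.+1.
Proof.
move=> le eq; suff main d : process G (t + d) = process G t.
  by rewrite -(subnKC le) -addnS !main.
by elim: d => [|d IH]; rewrite ?addn0 // addnS processS IH -processS -eq.
Qed.

Lemma running_time_stall G :
  process G (running_time H G) = process G (running_time H G).+1.
Proof. by rewrite /running_time; case: ex_minnP => t /eqP. Qed.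

Lemma running_time_le G t : process G t = process G t.+1 -> running_time H G <= t.
Proof. by move=> eq; rewrite /running_time; case: ex_minnP => t' _; apply; apply/eqP. Qed.

Lemma process_simple G t : simple_graph G -> simple_graph (process G t).
Proof.
move=> /forall_inP G2; elim: t => [|t /forall_inP IH]; first exact/forall_inP.
by apply/forall_inP => e /bootstrap_stepP[/IH //|[->]].
Qed.

Lemma process_automorphism G t (g : T -> T) : injective g ->
    (forall e, e \in G -> g @: e \in G) ->
  forall e, e \in process G t -> g @: e \in process G t.
Proof.
move=> gi gG; elim: t => // t IH e /bootstrap_stepP[/IH eG|[e2 [f [fi [h0 h0H eE] fH]]]].
  by apply/bootstrap_stepP; left.
apply/bootstrap_stepP; right; split; first by rewrite card_imset.
exists (g \o f); split; first exact: inj_comp.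
  by exists h0; rewrite // imset_comp eE.
move=> h hH; rewrite imset_comp; have := fH h hH; rewrite !inE => /orP[/eqP ->|/IH ->].
  by rewrite eqxx.
by rewrite orbT.
Qed.

Definition delete (B : {set T}) G := [set e in G | [disjoint e & B]].

(** * Deletion of one of many exchangeable branches *)

Section DeleteBranch.

Variables (G : {set {set T}}) (m : nat) (B : {set T}) (sigma : 'I_m -> T -> T).
Hypotheses (G_simple : simple_graph G) (m_large : #|U| + 2 < m)
  (sw : branch_swaps (adj G) (fun=> tt) (cover G) B sigma).

(** By [swap_inj] each vertex of [W] is sent into [B] by at most one of the [m] exchanges. *)
Lemma swap_avoids (W : {set T}) : #|W| < m ->
  exists j, forall x, x \in W -> sigma j x \notin B.
Proof.
move=> small; suff: [exists j, [forall x in W, sigma j x \notin B]].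
  by case/existsP => j /forall_inP; exists j.
apply: contraLR small; rewrite negb_exists -leqNgt => /forallP hit.
have {hit} hit j : exists2 x, x \in W & sigma j x \in B.
  by have := hit j; rewrite negb_forall_in => /exists_inP[x xW /negPn]; exists x.
have [m0|m_gt0] := posnP m; first by rewrite m0.
have [x0 _ _] := hit (Ordinal m_gt0).
pose g j := odflt x0 [pick x in W | sigma j x \in B].
have gP j : g j \in W /\ sigma j (g j) \in B.
  rewrite /g; case: pickP => [x /andP[] //|none].
  by have [x xW sB] := hit j; have := none x; rewrite xW sB.
have g_inj : injective g.
  by move=> i j eq; apply: (swap_inj sw (x := g i)); [case: (gP i) | rewrite eq; case: (gP j)].
rewrite -[m in m <= _]card_ord -(card_imset _ g_inj); apply: subset_leq_card.
by apply/subsetP => _ /imsetP[j _ ->]; case: (gP j).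
Qed.

Lemma swap_graph j e : e \in G -> sigma j @: e \in G.
Proof.
move=> eG; have /cards2P[x [y [_ exy]]] : #|e| == 2 by apply: (forall_inP G_simple).
have xS : x \in cover G by apply/bigcupP; exists e; rewrite // exy set21.
have yS : y \in cover G by apply/bigcupP; exists e; rewrite // exy set22.
rewrite {1}exy imsetU1 imset_set1.
by have := swap_rel sw j xS yS; rewrite /= => ->; rewrite -exy.
Qed.

Let swap_process j t e : e \in process G t -> sigma j @: e \in process G t.
Proof.
by move=> eG; apply: process_automorphism eG; [apply: inv_inj (swapK sw j) | apply: swap_graph].
Qed.

(** The copy of the pattern that creates [e] may meet [B]. An exchange that sends none of its
    vertices into [B] moves the copy away from [B] and fixes [e], because neither [e] nor its image
    meets [B]. *)
Lemma delete_process t : delete B (process G t) \subset process (delete B G) t.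
Proof.
elim: t => // t IH; apply/subsetP => e; rewrite inE => /andP[].
case/bootstrap_stepP => [eG dis|[e2 [f [fi [h0 h0H eE] fH]]] dis].
  by apply/bootstrap_stepP; left; apply: (subsetP IH); rewrite inE eG.
have [|j avoid] := @swap_avoids (f @: [set: U]).
  by rewrite card_imset // cardsT; lia.
have inW (h : {set U}) : f @: h \subset f @: [set: U] by apply: imsetS (subsetT h).
have out (h : {set U}) : [disjoint sigma j @: (f @: h) & B].
  rewrite disjoint_subset; apply/subsetP => _ /imsetP[x /(subsetP (inW h)) /avoid ? ->].
  by rewrite inE.
have fixe : sigma j @: e = e.
  rewrite -[RHS]imset_id; apply: eq_in_imset => x xe.
  apply: (swap_id sw); first by rewrite (disjointFr dis).
  by apply: avoid; apply: (subsetP (inW h0)); rewrite -eE.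
apply/bootstrap_stepP; right; split=> //; exists (sigma j \o f); split.
- by apply: inj_comp fi; apply: inv_inj (swapK sw j).
- by exists h0; rewrite // imset_comp -eE fixe.
move=> h hH; rewrite imset_comp; have := fH h hH; rewrite !inE => /orP[/eqP ->|fG].
  by rewrite fixe eqxx.
by rewrite (subsetP IH) ?orbT // inE swap_process ?out.
Qed.

(** An edge of the next graph is moved off [B], so the deleted process contains its image, by the
    stall already at time [t]. Applying the same exchange again brings the edge back. *)
Lemma delete_stall t : process (delete B G) t = process (delete B G) t.+1 ->
  process G t = process G t.+1.
Proof.
move=> stall; apply/eqP; rewrite eqEsubset step_sub /=; apply/subsetP => e eG.
have e2 : #|e| = 2 by apply/eqP/(forall_inP (process_simple t.+1 G_simple)).
have [|j avoid] := @swap_avoids e; first by rewrite e2; lia.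
have : sigma j @: e \in delete B (process G t.+1).
  rewrite inE swap_process //= disjoint_subset; apply/subsetP => _ /imsetP[x xe ->].
  by rewrite inE avoid.
move/(subsetP (delete_process t.+1)); rewrite -stall.
have sub : delete B G \subset G by apply/subsetP => x; rewrite inE => /andP[].
move/(subsetP (process_mono t sub))/(swap_process j).
by rewrite -imset_comp (eq_imset _ (swapK sw j)) imset_id.
Qed.

Lemma delete_cover : #|cover (delete B G)| < #|cover G|.
Proof.
have /set0Pn[b bB] := branch_neq0 sw.
apply: proper_card; apply/properP; split.
  apply/subsetP => x /bigcupP[e]; rewrite inE => /andP[eG _] xe.
  by apply/bigcupP; exists e.
exists b; first exact: (subsetP (branch_sub sw)).
apply/bigcupP => -[e]; rewrite inE => /andP[_ dis] be.
by rewrite (disjointFr dis be) in bB.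
Qed.

End DeleteBranch.

End Process.

Hypothesis H_min_degree : forall h u, h \in H -> u \in h ->
  exists h', [/\ h' \in H, h' != h & u \in h'].

(** Each end of a new edge lies on a second edge of the copy, and that edge was already present. *)
Lemma process_cover (T : finType) (G : {set {set T}}) t :
  cover (bootstrap_process H G t) \subset cover G.
Proof.
elim: t => // t IH; apply: subset_trans IH; apply/subsetP => x /bigcupP[e].
case/bootstrap_stepP=> [eG xe|[e2 [f [fi [h0 h0H ->] fH]]]].
  by apply/bigcupP; exists e.
case/imsetP=> u uh0 ->; have [h [hH hh0 uh]] := H_min_degree h0H uh0.
apply/bigcupP; exists (f @: h); last exact: imset_f.
have := fH h hH; rewrite !inE => /orP[/eqP|//].
by move/(imset_inj fi) => eq; rewrite eq eqxx in hh0.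
Qed.

(** While more than [N] vertices are covered, a branch can be deleted without making the process
    stall later than it does afterwards. In the end all edges are subsets of a set of at most [N]
    vertices, which gives [2 ^ N] independently of [T]. *)
Lemma short_paths_running_time L : exists M, forall (T : finType) (G : {set {set T}}),
    simple_graph G ->
    (forall x p, path (adj G) x p -> uniq (x :: p) -> size p < L) ->
  running_time H G <= M.
Proof.
pose m := #|U| + 3.
have [N HN] := branch_swaps_exist L unit m.
exists (2 ^ N) => T G G_simple G_short; apply: running_time_le.
have [n] := ubnP #|cover G|; elim: n G G_simple G_short => // n IH G G_simple G_short.
rewrite ltnS => le_n; have [small|large] := leqP #|cover G| N.
  have sub t : bootstrap_process H G t \subset powerset (cover G).
    apply/subsetP => e eG; rewrite powersetE; apply: subset_trans (process_cover G t).
    exact: bigcup_sup eG.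
  have [t le st] := nested_sets_stall (fun t => step_sub (bootstrap_process H G t)) sub.
  apply: process_stall st; apply: leq_trans le _.
  by rewrite card_powerset leq_exp2l.
have [||B [sigma sw]] := HN T (adj G) (fun=> tt) (cover G) _ _ large.
- by move=> x y; rewrite /= setUC.
- move=> x xG; exists x; split=> // p pp; apply: G_short.
  by apply: sub_path pp => y z /and3P[].
have sub : delete B G \subset G by apply/subsetP => e; rewrite inE => /andP[].
apply: (delete_stall G_simple _ sw); first by rewrite /m; lia.
apply: IH.
- by apply/forall_inP => e /(subsetP sub)/(forall_inP G_simple).
- move=> x p pp; apply: G_short; apply: sub_path pp => y z; exact: (subsetP sub).
- exact: leq_trans (delete_cover sw) le_n.
Qed.

End Pattern.

(** * Unions of cycles *)

Lemma set2_eq (T : finType) (x y x' y' : T) : [set x; y] = [set x'; y'] ->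
  (x = x' /\ y = y') \/ (x = y' /\ y = x').
Proof.
move=> eq; have := set21 x y; have := set22 x y; rewrite eq !inE.
have := set21 x' y'; have := set22 x' y'; rewrite -eq !inE.
move=> /orP[]/eqP ? /orP[]/eqP ? /orP[]/eqP ? /orP[]/eqP ?; subst; by [left | right].
Qed.

Lemma imset_pair (T T' : finType) (f : T -> T') x y :
  f @: [set x; y] = [set f x; f y].
Proof. by rewrite imsetU1 imset_set1. Qed.

Lemma val_iter_ordS n (c : 'I_n) l : iter l (@ordS n) c = (c + l) %% n :> nat.
Proof.
elim: l => [|l IH] /=; first by rewrite addn0 modn_small.
by rewrite IH -addn1 modnDml addn1 addnS.
Qed.

Lemma nth_path (T : eqType) (r : rel T) x0 z o l : sorted r z -> o + l < size z ->
  path r (nth x0 z o) [seq nth x0 z i | i <- iota o.+1 l].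
Proof.
move=> sz le; apply/(pathP x0) => i; rewrite size_map size_iota => lt_il.
rewrite -[_ :: _]/[seq nth x0 z i | i <- iota o l.+1].
rewrite !(nth_map 0) ?size_iota ?(ltnW lt_il) ?leqW // !nth_iota ?leqW // ?addSn.
case: z sz le => [|x p] /=; first by rewrite ltn0.
move=> pp le; have lt_oi : o + i < size p by lia.
exact: (pathP x0 pp (o + i) lt_oi).
Qed.

Lemma nth_path_uniq (T : eqType) (x0 : T) z o l : uniq z -> o + l < size z ->
  uniq (nth x0 z o :: [seq nth x0 z i | i <- iota o.+1 l]).
Proof.
move=> uz le.
rewrite -[_ :: _]/[seq nth x0 z i | i <- iota o l.+1].
rewrite map_inj_in_uniq ?iota_uniq // => i j; rewrite !mem_iota => Hi Hj /eqP.
by rewrite nth_uniq //; [move/eqP | lia | lia].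
Qed.

Lemma last_nth_path (T : Type) (x0 : T) z o l :
  last (nth x0 z o) [seq nth x0 z i | i <- iota o.+1 l] = nth x0 z (o + l).
Proof. by elim: l o => [|l IH] o; rewrite /= ?addn0 // IH addSnnS. Qed.

Section UnionOfCycles.

Variables (s : nat) (k : s.-tuple nat).
Hypothesis k_ge3 : all (leq 3) k.

Local Notation U := {i : 'I_s & 'I_(tnth k i)}.
Local Notation H := (union_of_cycles k).

Definition vtx (i : 'I_s) (c : 'I_(tnth k i)) : U :=
  Tagged (fun i => 'I_(tnth k i)) c.

Lemma tnth_ge3 i : 2 < tnth k i.
Proof. by apply: (allP k_ge3); apply: mem_tnth. Qed.

Lemma vtx_inj i : injective (@vtx i).
Proof. by move=> c c' /eqP; rewrite -tag_eqE /tag_eq eqxx tagged_asE => /eqP. Qed.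

Lemma union_of_cyclesP (h : {set U}) :
  reflect (exists i (c : 'I_(tnth k i)), h = [set vtx c; vtx (ordS c)]) (h \in H).
Proof.
apply: (iffP bigcupP) => [[i _ /imsetP[_ /imsetP[c _ ->] ->]]|[i [c ->]]].
  by exists i, c; rewrite imset_pair.
exists i => //; apply/imsetP; exists [set c; ordS c]; first exact: imset_f.
by rewrite imset_pair.
Qed.

Lemma ordS_neq i (c : 'I_(tnth k i)) : ordS c != c.
Proof.
rewrite -val_eqE /=; have := ltn_ord c; have := tnth_ge3 i.
have [lt|ge] := ltnP c.+1 (tnth k i); first by rewrite modn_small; lia.
by move=> ? ?; have -> : c.+1 = tnth k i; [lia | rewrite modnn; lia].
Qed.

Lemma ordSS_neq i (c : 'I_(tnth k i)) : ordS (ordS c) != c.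
Proof.
have k3 := tnth_ge3 i; have := val_iter_ordS c 2; rewrite -val_eqE /= => ->.
have [lt|ge] := ltnP (c + 2) (tnth k i); first by rewrite modn_small; lia.
have -> : c + 2 = (c + 2 - tnth k i) + tnth k i by rewrite subnK.
by have lt := ltn_ord c; rewrite modnDr modn_small; lia.
Qed.

Lemma edge_inj i (c c' : 'I_(tnth k i)) :
  [set vtx c; vtx (ordS c)] = [set vtx c'; vtx (ordS c')] -> c = c'.
Proof.
case/set2_eq=> -[/vtx_inj ec /vtx_inj ec'] //.
by have := ordSS_neq c'; rewrite -ec ec' eqxx.
Qed.

Lemma union_of_cycles_min_degree (h : {set U}) u : h \in H -> u \in h ->
  exists h', [/\ h' \in H, h' != h & u \in h'].
Proof.
case/union_of_cyclesP=> i [c ->]; rewrite !inE => /orP[]/eqP ->.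
  exists [set vtx (ord_pred c); vtx (ordS (ord_pred c))]; split.
  - by apply/union_of_cyclesP; exists i, (ord_pred c).
  - apply/eqP => /edge_inj e; have := ordS_neq (ord_pred c).
    by rewrite ord_predK {1}e eqxx.
  - by rewrite ord_predK set22.
exists [set vtx (ordS c); vtx (ordS (ordS c))]; split; last exact: set21.
- by apply/union_of_cyclesP; exists i, (ordS c).
- by apply/eqP => /edge_inj e; have := ordS_neq c; rewrite e eqxx.
Qed.

(** * Copies of a union of cycles and the paths that they close *)

Section Graph.

Variable T : finType.
Implicit Types (G : {set {set T}}) (f : U -> T).

Definition copy_in G f := injective f /\
  forall i (c : 'I_(tnth k i)), adj G (f (vtx c)) (f (vtx (ordS c))).

Lemma copy_in_sub G G' f : G \subset G' -> copy_in G f -> copy_in G' f.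
Proof. by move=> /subsetP sub [fi fG]; split=> // i c; apply: sub; apply: fG. Qed.

Lemma simple_adj G x y : simple_graph G -> adj G x y -> x != y.
Proof. by move=> /forall_inP G2 /G2; rewrite cards2; case: (x != y). Qed.

Lemma new_edge_copy G e : e \in bootstrap_step H G -> e \notin G ->
  exists2 f, copy_in (bootstrap_step H G) f & copy_in (e |: G) f.
Proof.
move=> eS eG; have /bootstrap_stepP[|[_ [f [fi _ fH]]]] := eS; first by rewrite (negbTE eG).
have fc : copy_in (e |: G) f.
  split=> // i c; rewrite /= -imset_pair; apply: fH.
  by apply/union_of_cyclesP; exists i, c.
exists f => //; apply: copy_in_sub fc; apply/subsetP => e'.
by case/setU1P => [->//|]; apply/subsetP/step_sub.
Qed.

(** Removing the new edge from its cycle in the copy leaves a path between its ends. *)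
Lemma new_edge_path G x y : adj (bootstrap_step H G) x y -> ~~ adj G x y ->
  exists p, [/\ (size p).+1 \in tval k, uniq (x :: p), path (adj G) x p & last x p = y].
Proof.
move=> /= eS eG; have /bootstrap_stepP[|[_ [f [fi [h0 h0H eE] fH]]]] := eS.
  by rewrite (negbTE eG).
have {h0H} /union_of_cyclesP[i [c h0E]] := h0H; subst h0.
set a := tnth k i; have a_ge3 : 2 < a := tnth_ge3 i.
have lt_ca : c < a := ltn_ord c.
(* The walk starts at [ordS c] and goes the long way round to [c], so that it never uses the edge
   from [c] to [ordS c], which is the new one. *)
pose z l := f (vtx (iter l (@ordS a) (ordS c))).
have z_inj l l' : l < a -> l' < a -> z l = z l' -> l = l'.
  move=> la l'a /fi/vtx_inj/(congr1 (@nat_of_ord _)); rewrite !val_iter_ordS => /eqP.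
  by rewrite eqn_modDl !modn_small // => /eqP.
have z_last : z a.-1 = f (vtx c).
  congr (f (vtx _)); apply: val_inj; rewrite /= val_iter_ordS /= modnDml addSnnS.
  by rewrite prednK ?modnDr ?modn_small //; lia.
pose p := [seq z l | l <- iota 1 a.-1].
have sz_p : size p = a.-1 by rewrite size_map size_iota.
have zpE : z 0 :: p = [seq z l | l <- iota 0 a] by rewrite -[in RHS](prednK (ltnW (ltnW a_ge3))).
have pk : (size p).+1 \in tval k by rewrite sz_p prednK ?mem_tnth //; lia.
have pu : uniq (z 0 :: p).
  rewrite zpE map_inj_in_uniq ?iota_uniq // => l l'; rewrite !mem_iota.
  by move=> /= la l'a; apply: z_inj.
have pp : path (adj G) (z 0) p.
  apply/(pathP (z 0)) => l; rewrite sz_p => lt_l.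
  rewrite zpE !(nth_map 0) ?size_iota // ?nth_iota //; try by lia.
  rewrite add0n add1n /=.
  have : f @: [set vtx (iter l (@ordS a) (ordS c)); vtx (iter l.+1 (@ordS a) (ordS c))]
      \in [set x; y] |: G.
    by apply: fH; apply/union_of_cyclesP; exists i, (iter l (@ordS a) (ordS c)).
  rewrite imset_pair => /setU1P[|//]; rewrite eE -imset_pair.
  move/(imset_inj fi)/edge_inj => ec; have : z l = z a.-1 by rewrite z_last /z ec.
  by move/z_inj; lia.
have pl : last (z 0) p = f (vtx c).
  rewrite -z_last (last_nth (z 0)) sz_p zpE (nth_map 0) ?size_iota ?nth_iota //; lia.
have : [set x; y] = [set z 0; last (z 0) p].
  by rewrite pl eE imset_pair setUC.
case/set2_eq=> -[-> ->]; first by exists p.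
exists (rev (belast (z 0) p)); split.
- by rewrite size_rev size_belast.
- by rewrite -cons_uniq -rev_rcons -lastI rev_uniq.
- rewrite rev_path; apply: sub_path pp => u v /=; by rewrite setUC.
- by case: (p) => //= w q; rewrite rev_cons last_rcons.
Qed.

(** In the copy [f], the cycle of the right length is replaced by the path and its chord; the other
    cycles stay in place, disjoint from the path. *)
Lemma path_closes G f x p : copy_in G f -> (forall u, f u \notin x :: p) ->
    (size p).+1 \in tval k -> uniq (x :: p) -> path (adj G) x p ->
  adj (bootstrap_step H G) x (last x p).
Proof.
move=> [fi fG] f_avoid /tnthP[i pk] pu pp.
have p_ge2 : 2 <= size p by have := tnth_ge3 i; rewrite -pk.
pose g (u : U) := if tag u == i then nth x (x :: p) (nat_of_ord (tagged u)) else f u.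
have gi (c : 'I_(tnth k i)) : g (vtx c) = nth x (x :: p) c by rewrite /g /= eqxx.
have gj j (c : 'I_(tnth k j)) : j != i -> g (vtx c) = f (vtx c) by rewrite /g /= => /negbTE ->.
have lt_size (c : 'I_(tnth k i)) : c < size (x :: p) by rewrite /= pk.
apply/bootstrap_stepP; right; split.
  have [xp _] := andP pu; rewrite cards2; case: eqP => // xl; case/negP: xp.
  by rewrite {1}xl; case: (p) p_ge2 => //= y r _; apply: mem_last.
have k_gt0 : 0 < tnth k i by have := tnth_ge3 i; lia.
pose c0 := Ordinal k_gt0.
have lt_p : size p < tnth k i by rewrite -pk.
pose c1 := Ordinal lt_p.
have c1S : ordS c1 = c0 by apply: val_inj; rewrite /= pk modnn.
have gE : [set x; last x p] = g @: [set vtx c1; vtx (ordS c1)].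
  by rewrite c1S imset_pair !gi /= nth_last setUC.
exists g; split.
- move=> [j c] [j' c']; rewrite -[existT _ j c]/(vtx c) -[existT _ j' c']/(vtx c').
  have [ji|ji] := eqVneq j i; have [j'i|j'i] := eqVneq j' i; subst.
  + rewrite !gi => /eqP; rewrite nth_uniq // => /eqP/val_inj -> //.
  + rewrite gi gj // => cc'; have := f_avoid (vtx c'); by rewrite -cc' mem_nth.
  + rewrite gi gj // => cc'; have := f_avoid (vtx c); by rewrite cc' mem_nth.
  + by rewrite !gj // => /fi.
- exists [set vtx c1; vtx (ordS c1)] => //; by apply/union_of_cyclesP; exists i, c1.
move=> _ /union_of_cyclesP[j [c ->]]; rewrite !inE.
have [ji|ji] := eqVneq j i; last by rewrite imset_pair !gj // [_ \in G]fG orbT.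
subst j; have [lt|c_ge] := ltnP c (size p).
  apply/orP; right; rewrite imset_pair !gi [nat_of_ord (ordS c)]/= modn_small.
    exact: (pathP x pp c lt).
  exact: leq_ltn_trans lt lt_p.
have -> : c = c1.
  by apply/val_inj/eqP; rewrite eqn_leq c_ge andbT; apply: (lt_size c).
by rewrite gE eqxx.
Qed.

Variable k1 : nat.
Hypothesis k_le : {in tval k, forall a, a <= k1}.

Let tnth_le i : tnth k i <= k1. Proof. exact/k_le/mem_tnth. Qed.

(** Among [#|W|.+1] disjoint blocks of length [w], each vertex of [W] meets at most one. *)
Lemma block_avoiding (x0 : T) (z : seq T) (W : {set T}) w : uniq z ->
    #|W|.+1 * w <= size z ->
  exists2 o, o + w <= size z & forall i, i < w -> nth x0 z (o + i) \notin W.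
Proof.
move=> uz le.
suff [b avoid] : exists b : 'I_(#|W|.+1), forall i : 'I_w, nth x0 z (b * w + i) \notin W.
  exists (b * w); last by move=> i lt_iw; apply: (avoid (Ordinal lt_iw)).
  by apply: leq_trans le; rewrite -mulSnr leq_mul2r ltn_ord orbT.
suff: [exists b : 'I_(#|W|.+1), [forall i : 'I_w, nth x0 z (b * w + i) \notin W]].
  by case/existsP => b /forallP; exists b.
have := leqnn #|W|; apply: contraLR; rewrite negb_exists -ltnNge => /forallP hit.
have {hit} hit (b : 'I_(#|W|.+1)) : exists i : 'I_w, nth x0 z (b * w + i) \in W.
  by have := hit b; rewrite negb_forall => /existsP[i /negPn]; exists i.
pose g (b : 'I_(#|W|.+1)) := nth x0 z (b * w + xchoose (hit b)).
have lt_g (b : 'I_(#|W|.+1)) (i : 'I_w) : b * w + i < size z.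
  apply: leq_trans le; apply: (@leq_trans (b.+1 * w)); last by rewrite leq_mul2r ltn_ord orbT.
  by rewrite mulSnr ltn_add2l.
have g_inj : injective g.
  move=> b b' /eqP; rewrite nth_uniq ?lt_g // => /eqP /(congr1 (divn^~ w)).
  have w_gt0 : 0 < w by apply: leq_ltn_trans (ltn_ord (xchoose (hit b))).
  by rewrite !divnMDl // !divn_small // !addn0 => /val_inj.
rewrite -[X in X <= _](card_ord #|W|.+1) -(card_imset _ g_inj); apply: subset_leq_card.
by apply/subsetP => _ /imsetP[b _ ->]; apply: (xchooseP (hit b)).
Qed.

(** The first step must have created a copy [f0]. A stretch of the path that avoids [f0] and [W] is
    cut into one window per cycle, and the second step closes the windows with the help of [f0]. *)
Lemma copies_avoiding G x0 p (W : {set T}) : simple_graph G ->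
    bootstrap_step H G != G -> path (adj G) x0 p -> uniq (x0 :: p) ->
    (#|{: U}| + #|W|).+1 * (s * k1) <= size p ->
  exists2 f, copy_in (bootstrap_step H (bootstrap_step H G)) f & forall u, f u \notin W.
Proof.
move=> G_simple new pp pu long; set G1 := bootstrap_step H G.
have [f0 f0G1] : exists f0, copy_in G1 f0.
  have /subsetPn[e eS eG] : ~~ (G1 \subset G).
    by apply: contra new => sub; rewrite eqEsubset sub step_sub.
  by have [f0 f0c _] := new_edge_copy eS eG; exists f0.
pose W' := W :|: f0 @: [set: {: U}].
have card_W' : #|W'| <= #|{: U}| + #|W|.
  rewrite addnC (leq_trans (leq_card_setU _ _)) // leq_add2l.
  by rewrite (leq_trans (leq_imset_card _ _)) // cardsT.
set z := x0 :: p; have z_size : size z = (size p).+1 by [].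
have [|o le_o avoid] := @block_avoiding x0 z W' (s * k1) pu.
  by rewrite z_size leqW // (leq_trans _ long) // leq_mul2r ltnS card_W' orbT.
(* Cycle [i] occupies the beginning of the [i]-th window of length [k1]. *)
pose pos (u : U) := tag u * k1 + nat_of_ord (tagged u).
have pos_lt u : pos u < s * k1.
  have lt1 : nat_of_ord (tagged u) < k1 := leq_trans (ltn_ord _) (tnth_le (tag u)).
  apply: (@leq_trans ((tag u).+1 * k1)); first by rewrite mulSnr ltn_add2l.
  by rewrite leq_mul2r ltn_ord orbT.
have posv i (c : 'I_(tnth k i)) : pos (vtx c) = i * k1 + c by [].
have o_lt u : o + pos u < size z by apply: leq_trans le_o; rewrite ltn_add2l.
pose f u := nth x0 z (o + pos u).
have f_W' u : f u \notin W' by apply: avoid.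
exists f; last first.
  by move=> u; have := f_W' u; rewrite inE negb_or => /andP[].
have f_inj : injective f.
  move=> u u' /eqP; rewrite nth_uniq ?o_lt // eqn_add2l => /eqP.
  case: u => i c; case: u' => i' c'; rewrite -[existT _ i c]/(vtx c) -[existT _ i' c']/(vtx c').
  rewrite !posv => eq.
  have lt_c : c < k1 := leq_trans (ltn_ord c) (tnth_le i).
  have lt_c' : c' < k1 := leq_trans (ltn_ord c') (tnth_le i').
  have k1_gt0 : 0 < k1 by apply: leq_ltn_trans lt_c.
  have ii' : i = i'.
    apply/val_inj; have := congr1 (divn^~ k1) eq.
    by rewrite !divnMDl // !divn_small // !addn0.
  by subst i'; move/addnI: eq => /val_inj ->.
have fv i (c : 'I_(tnth k i)) : f (vtx c) = nth x0 z (o + i * k1 + c).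
  by rewrite /f posv addnA.
split=> // i c; rewrite /adj !fv [nat_of_ord (ordS c)]/=.
set o' := o + i * k1.
have o'_lt (c' : 'I_(tnth k i)) : o' + c' < size z.
  by have := o_lt (vtx c'); rewrite posv addnA.
have [lt|c_ge] := ltnP c.+1 (tnth k i).
  rewrite modn_small // addnS; apply: (subsetP (step_sub H G1)).
  apply: (subsetP (step_sub H G)).
  have lt' := o'_lt (Ordinal lt); rewrite /= addnS ltnS in lt'.
  exact: (pathP x0 pp (o' + c) lt').
have cE : c.+1 = tnth k i by apply/eqP; rewrite eqn_leq c_ge ltn_ord.
rewrite [X in nth _ _ (_ + X %% _)]cE modnn addn0 setUC -(last_nth_path x0 z o' c).
apply: (path_closes f0G1).
- move=> u; rewrite -[_ :: _]/[seq nth x0 z l | l <- iota o' c.+1].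
  apply/mapP => -[l]; rewrite mem_iota => /andP[le_l lt_l] f0u.
  have : nth x0 z (o + (i * k1 + (l - o'))) \notin W'.
    apply: avoid; apply: leq_ltn_trans (pos_lt (vtx c)).
    by rewrite posv leq_add2l; lia.
  have -> : o + (i * k1 + (l - o')) = l by rewrite addnA subnKC.
  by rewrite -f0u inE imset_f ?orbT.
- by rewrite size_map size_iota cE mem_tnth.
- exact: nth_path_uniq pu (o'_lt c).
- apply: (sub_path (e := adj G)); last exact: nth_path (o'_lt c).
  by move=> x y; apply: (subsetP (step_sub H G)).
Qed.

Lemma long_path_running_time G x0 p j q : q.+1 = k1 -> k1 \in tval k ->
    simple_graph G -> path (adj G) x0 p -> uniq (x0 :: p) ->
    (#|{: U}| + k1).+1 * (s * k1) <= size p -> #|T| <= q ^ j ->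
  running_time H G <= j + q.+1 ^ 2 + q.*2.*2 + 8 + 2.
Proof.
move=> qk1 k1_k G_simple pp pu long le_T; apply: running_time_le.
have [stall|new] := eqVneq (bootstrap_step H G) G.
  by apply: (@process_stall _ _ _ _ 0) => //; rewrite processS stall.
pose A t := adj (bootstrap_process H G (t + 2)).
have A_simple t : simple_graph (bootstrap_process H G t) by apply: process_simple.
(* From time 2 on, every path on at most [k1] vertices is avoided by some copy, which is what lets
   the process behave freely. *)
have robust t (W : {set T}) : #|W| <= k1 ->
    exists2 f, copy_in (bootstrap_process H G (t + 2)) f & forall u, f u \notin W.
  move=> le_W; have [|f fc f_avoid] := copies_avoiding (W := W) G_simple new pp pu.
    by apply: leq_trans long; rewrite leq_mul2r ltnS leq_add2l le_W orbT.
  by exists f => //; apply: copy_in_sub fc; apply: (@process_le _ H _ G 2); rewrite leq_addl.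
have A_settles x y : A (j + q.+1 ^ 2 + q.*2.*2 + 8).+1 x y = A (j + q.+1 ^ 2 + q.*2.*2 + 8) x y.
  have := @free_process_settles T (tval k) A k_ge3 _ _ _ _ _ j q 0.
  rewrite add0n; apply.
  - by move=> t a b; rewrite /A /= setUC.
  - by move=> t a; apply/negP => /(simple_adj (A_simple _)); rewrite eqxx.
  - by move=> t a b; apply: (subsetP (step_sub H _)).
  - move=> t a r r_k r_u r_p.
    have [|f fc f_avoid] := robust t [set y in a :: r].
      by rewrite cardsE (card_uniqP r_u) k_le.
    by apply: (path_closes fc) => // u; have := f_avoid u; rewrite inE.
  - by move=> t a b; apply: new_edge_path.
  - by rewrite qk1.
  - by move=> a /k_le; rewrite qk1.
  - exact: le_T.
apply/setP => e; apply/idP/idP; first exact/subsetP/step_sub.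
move=> eG; have : #|e| == 2 by exact: (forall_inP (A_simple _) _ eG).
by case/cards2P=> a [b [_ eab]]; have := A_settles a b; rewrite /A /adj -eab eG.
Qed.

End Graph.

End UnionOfCycles.

Lemma running_time_bound (s : nat) (k : s.-tuple nat) q : all (leq 3) k ->
    {in tval k, forall a, a <= q.+1} -> q.+1 \in tval k ->
  exists M, forall n j (G : {set {set 'I_n}}), simple_graph G -> n <= q ^ j ->
    running_time (union_of_cycles k) G <= maxn M (j + q.+1 ^ 2 + q.*2.*2 + 10).
Proof.
move=> k_ge3 k_le q_k.
pose L := (#|{: {i : 'I_s & 'I_(tnth k i)}}| + q.+1).+1 * (s * q.+1).
have [M HM] := short_paths_running_time (@union_of_cycles_min_degree s k k_ge3) L.
exists M => n j G G_simple le_n; rewrite leq_max.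
have [[x [p [pp pu long]]]|none] := EM (exists x p,
    [/\ path (adj G) x p, uniq (x :: p) & L <= size p]).
  apply/orP; right; rewrite -[10]/(8 + 2) addnA.
  by apply: (long_path_running_time k_ge3 k_le (erefl _) q_k G_simple pp pu long); rewrite card_ord.
apply/orP; left; apply: HM => // x p pp pu; rewrite ltnNge; apply/negP => long.
by apply: none; exists x, p.
Qed.

(** * The lower bound *)

Section LowerBound.

Variables (s : nat) (k : s.-tuple nat) (q n : nat).
Hypotheses (k_ge3 : all (leq 3) k) (k_le : {in tval k, forall a, a <= q.+1})
  (q_k : q.+1 \in tval k).

Local Notation U := {i : 'I_s & 'I_(tnth k i)}.
Local Notation H := (union_of_cycles k).
Local Notation m := (n - #|{: U}|).

Hypothesis n_large : #|{: U}| < n.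

Let rank_lt (u : U) : m + enum_rank u < n.
Proof. by have := ltn_ord (enum_rank u); rewrite -ltn_subRL subKn // ltnW. Qed.

Definition spare_copy (u : U) : 'I_n := Ordinal (rank_lt u).

(** The path runs through the vertices below [m]. The copy on the remaining vertices supplies the
    other cycles whenever a piece of the path is closed. *)
Definition long_path_graph : {set {set 'I_n}} :=
  [set e | [exists x : 'I_n, [exists y : 'I_n,
     [&& e == [set x; y], y == x.+1 :> nat & y < m]]]]
  :|: [set spare_copy @: h | h : {set U} in H].

Local Notation G := long_path_graph.

Lemma spare_copy_inj : injective spare_copy.
Proof. by move=> u v /(congr1 val)/= /addnI/val_inj/enum_rank_inj. Qed.

Lemma long_path_graph_simple : simple_graph G.
Proof.
apply/forall_inP => e /setUP[|/imsetP[_ /union_of_cyclesP[i [c ->]] ->]].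
  rewrite inE => /existsP[x /existsP[y /and3P[/eqP -> /eqP yx _]]].
  by rewrite cards2 -val_eqE /= yx (ltn_eqF (ltnSn x)).
have := ordS_neq k_ge3 c; rewrite imset_pair cards2 eq_sym.
by rewrite (inj_eq spare_copy_inj) (inj_eq (@vtx_inj _ _ _)) => ->.
Qed.

Lemma spare_copy_in t : copy_in (bootstrap_process H G t) spare_copy.
Proof.
apply: (@copy_in_sub _ _ _ G); first exact: (@process_le _ H _ G 0).
split; first exact: spare_copy_inj.
move=> i c; rewrite /adj -imset_pair; apply/setUP; right; apply: imset_f.
by apply/union_of_cyclesP; exists i, c.
Qed.

(** Distance along the initial path is measured by the labels. The second alternative allows all
    pairs in the spare copy, and no pair joins it to the path. *)
Definition stretch (d : nat) : rel 'I_n := fun x y =>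
  [&& x < m, y < m, x <= y + d & y <= x + d] || (m <= x) && (m <= y).

Lemma stretch_trans d d' x y z : stretch d x y -> stretch d' y z -> stretch (d + d') x z.
Proof. by rewrite /stretch; lia. Qed.

Lemma stretch_le d d' x y : d <= d' -> stretch d x y -> stretch d' x y.
Proof. by rewrite /stretch; lia. Qed.

Lemma stretch_mem d x p y : path (stretch d) x p -> x < m -> y \in x :: p -> y < m.
Proof.
elim: p x => [|z p IH] x /=; first by move=> _ xm; rewrite inE => /eqP ->.
case/andP=> xz zp xm; rewrite inE => /predU1P[-> //|]; apply: IH => //.
by move: xz; rewrite /stretch; lia.
Qed.

Lemma stretch_path d x p : path (stretch d) x p -> stretch (size p * d) x (last x p).
Proof.
elim: p x => [|y p IH] x /=; first by rewrite /stretch; lia.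
by case/andP=> xy /IH; rewrite mulSn; apply: stretch_trans.
Qed.

(** A new edge closes a path of at most [q] edges, so the distance spanned grows by a factor of at
    most [q] per step. *)
Lemma process_stretch t x y : adj (bootstrap_process H G t) x y -> stretch (q ^ t) x y.
Proof.
elim: t x y => [|t IH] x y.
  rewrite expn0 => /setUP[|/imsetP[_ /union_of_cyclesP[i [c ->]]]].
    rewrite inE => /existsP[x' /existsP[y' /and3P[/eqP/set2_eq eq /eqP y'x' lt]]].
    by rewrite /stretch; case: eq => -[-> ->]; lia.
  by rewrite imset_pair => /set2_eq[] -[-> ->]; rewrite /stretch /= !leq_addr orbT.
rewrite processS; have [/IH xy _|old new] := boolP (adj (bootstrap_process H G t) x y).
  have q_gt0 : 0 < q by have := allP k_ge3 _ q_k; lia.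
  by apply: stretch_le xy; rewrite leq_pexp2l.
have [p [p_k _ pp <-]] := new_edge_path k_ge3 new old.
have := stretch_path (sub_path IH pp).
have le : size p * q ^ t <= q ^ t.+1 by rewrite expnS leq_mul2r -ltnS k_le ?orbT.
exact: stretch_le.
Qed.

Lemma long_path_connect t (x y : 'I_n) : x < m -> y < m ->
  connect (adj (bootstrap_process H G t)) x y.
Proof.
wlog le_xy : x y / x <= y => [wl|].
  move=> xm ym; have [/wl|/ltnW/wl wl'] := leqP x y; first exact.
  by rewrite sym_connect_sym ?wl' // => a b; rewrite /= setUC.
move=> xm; have [d] := ubnP (y - x); elim: d y le_xy => // d IH y le_xy lt ym.
have [eq|ne] := eqVneq (x : nat) y; first by rewrite (val_inj eq) connect0.
have lt_xy : x < y by rewrite ltn_neqAle ne.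
have lt_n : y.-1 < n by apply: leq_ltn_trans (leq_pred y) (ltn_ord y).
apply: (@connect_trans _ _ (Ordinal lt_n)).
  by apply: IH => /=; lia.
apply: connect1; apply: (subsetP (@process_le _ H _ G 0 t (leq0n t))).
apply/setUP; left; rewrite inE; apply/existsP; exists (Ordinal lt_n).
by apply/existsP; exists y; rewrite eqxx ym /= prednK ?eqxx //; lia.
Qed.

Lemma long_path_graph_slow : q * #|{: U}|.+1 <= n -> n <= q ^ (running_time H G).+1.
Proof.
move=> n_q; have q_gt1 : 1 < q by have := allP k_ge3 _ q_k; lia.
set t := running_time H G; set Gt := bootstrap_process H G t.
have stall : bootstrap_step H Gt = Gt by rewrite -processS -running_time_stall.
have m_gt0 : 0 < m by lia.
have lt_0 : 0 < n by lia.
have lt_m : m.-1 < n by lia.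
pose x0 := Ordinal lt_0; pose y0 := Ordinal lt_m.
have [p [pp lp pu pmin]] : exists p, [/\ path (adj Gt) x0 p, last x0 p = y0, uniq (x0 :: p)
    & forall p', path (adj Gt) x0 p' -> last x0 p' = y0 -> size p <= size p'].
  have ex : exists d, `[< exists p, [/\ path (adj Gt) x0 p, last x0 p = y0 & size p = d] >].
    have /connectP[p pp lp] : connect (adj Gt) x0 y0 by apply: long_path_connect; rewrite /=; lia.
    by exists (size p); apply/asboolP; exists p.
  case: (ex_minnP ex) => d /asboolP[p0 [pp0 lp0 sz0]] dmin.
  have := lp0; have [p pp pu sub] := shortenP pp0 => lp.
  exists p; split=> // p' pp' lp'; apply: (@leq_trans d); last first.
    by apply: dmin; apply/asboolP; exists p'.
  by rewrite -sz0 uniq_leq_size //; case/andP: pu.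
have sp := sub_path (@process_stretch t) pp.
(* In a stable graph a shortest path with [q] or more edges would have a chord across its first [q]
   edges, since the spare copy is disjoint from it. *)
have short : size p < q.
  rewrite ltnNge; apply/negP => le_q.
  move: pp pu sp lp pmin; rewrite -(cat_take_drop q p); set p1 := take q p; set p2 := drop q p.
  have sz1 : size p1 = q by rewrite size_takel.
  rewrite cat_path -cat_cons cat_uniq last_cat => /andP[pp1 pp2] /and3P[pu1 _ _].
  rewrite cat_path => /andP[sp1 _] lp pmin.
  have short_cut : adj Gt x0 (last x0 p1).
    rewrite -stall; apply: (path_closes k_ge3 (spare_copy_in t)) => //; last by rewrite sz1.
    move=> u; apply/negP => /(stretch_mem sp1 m_gt0) /=.
    by rewrite ltnNge leq_addr.
  have pp' : path (adj Gt) x0 (last x0 p1 :: p2) by apply/andP.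
  by have := pmin _ pp' lp; rewrite size_cat sz1 /=; clear -q_gt1; lia.
have dist : m.-1 <= size p * q ^ t.
  by have := stretch_path sp; rewrite lp /stretch /= add0n; clear -m_gt0; lia.
rewrite expnS; set Q := q ^ t in dist *.
have le_pQ : size p * Q <= q.-1 * Q by rewrite leq_mul2r; lia.
have qQ : q * Q = q.-1 * Q + Q by rewrite -mulSnr prednK // ltnW.
(* With [u] for [#|{: U}|], the bound is [n <= q.-1 * Q + u + 1]. This is at most [q * Q] if
   [u < Q]; otherwise it gives [n <= q * u + 1], which contradicts [q * u.+1 <= n]. *)
have [le_Q|lt_Q] := leqP #|{: U}|.+1 Q; first by clear -qQ le_Q le_pQ dist; lia.
have le_qQ : q.-1 * Q <= q.-1 * #|{: U}| by rewrite leq_mul2l -ltnS lt_Q orbT.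
have qU : q * #|{: U}|.+1 = q.-1 * #|{: U}| + #|{: U}| + q.
  by rewrite mulnS addnC -mulSnr prednK // ltnW.
by clear -qQ le_qQ le_pQ dist qU n_q q_gt1; lia.
Qed.

End LowerBound.

(** * Powers of [q] and the logarithm to base [q] *)

Section LogBase.

Import Order.TTheory GRing.Theory Num.Theory.
Local Open Scope ring_scope.

Lemma ln_exp_nat (R : realType) (q j : nat) : (0 < q)%N ->
  ln ((q ^ j)%N%:R : R) = ln (q%:R : R) *+ j.
Proof. by move=> q_gt0; rewrite natrX lnXn ?ltr0n. Qed.

Lemma log_base_ge (R : realType) (q j n : nat) : (1 < q)%N -> (q ^ j <= n)%N ->
  (j%:R : R) <= log_base q%:R n%:R.
Proof.
move=> q_gt1 le; have q_gt0 := ltnW q_gt1; have qj_gt0 : (0 < q ^ j)%N by rewrite expn_gt0 q_gt0.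
rewrite /log_base ler_pdivlMr ?ln_gt0 ?ltr1n // mulr_natl -ln_exp_nat //.
by rewrite ler_ln ?posrE ?ltr0n ?ler_nat // (leq_trans qj_gt0).
Qed.

Lemma log_base_le (R : realType) (q j n : nat) : (1 < q)%N -> (0 < n)%N ->
  (n <= q ^ j)%N -> log_base q%:R n%:R <= (j%:R : R).
Proof.
move=> q_gt1 n_gt0 le; have q_gt0 := ltnW q_gt1.
rewrite /log_base ler_pdivrMr ?ln_gt0 ?ltr1n // mulr_natl -ln_exp_nat //.
by rewrite ler_ln ?posrE ?ltr0n ?ler_nat // (leq_trans n_gt0).
Qed.

Lemma log_base_sub1_le (R : realType) (q n t : nat) : (1 < q)%N -> (0 < n)%N ->
  (n <= q ^ t.+1)%N -> log_base q%:R n%:R - 1 <= (t%:R : R).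
Proof. by move=> q_gt1 n_gt0 le; rewrite lerBlDr natr1; apply: log_base_le. Qed.

Lemma lt_log_base_add (R : realType) (q n j c N t : nat) : (1 < q)%N ->
  (q ^ j <= n)%N -> (c < N)%N -> (t <= j + c)%N ->
  (t%:R : R) < log_base q%:R n%:R + N%:R.
Proof.
move=> q_gt1 le lt_c le_t; apply: (@le_lt_trans _ _ (j + c)%:R); first by rewrite ler_nat.
by rewrite natrD ler_ltD ?log_base_ge // ltr_nat.
Qed.

End LogBase.

(** * Both bounds for large [n] *)

Theorem theorem1p4 (R : realType) (s : nat) (k : s.-tuple nat)
    (hs : 2 <= s) (hdecr : sorted geq k) (hk : all (leq 3) k) :
  let k1 := nth 0 k 0 in
  exists n0 : nat, forall n : nat, n0 <= n ->
    (log_base (R := R) (k1%:R - 1) n%:R - 1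
       <= (max_running_time (union_of_cycles k) n)%:R)%R /\
    ((max_running_time (union_of_cycles k) n)%:R
       < log_base (R := R) (k1%:R - 1) n%:R + 6 * s%:R ^+ 6 * k1%:R ^+ 2)%R.
Proof.
move=> k1.
have k1_k : k1 \in tval k by apply: mem_nth; rewrite size_tuple; lia.
have k1_ge3 : 2 < k1 := allP hk _ k1_k.
have k_le : {in tval k, forall a, a <= k1}.
  move: hdecr; rewrite /k1; case: (tval k) => [|a l] //= a_l b.
  rewrite inE => /predU1P[-> //|]; apply/allP: b.
  have geq_trans : transitive geq by move=> x y z /= yx zy; apply: leq_trans zy yx.
  exact: order_path_min a_l.
pose q := k1.-1; have k1E : k1 = q.+1 by rewrite prednK // ltnW // ltnW.
have q_gt1 : 1 < q by lia.
have q_real : (k1%:R - 1 = q%:R :> R)%R by rewrite k1E -addn1 GRing.natrD GRing.addrK.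
rewrite k1E in k1_k k_le.
have [M HM] := running_time_bound hk k_le k1_k.
set K := #|{: {i : 'I_s & 'I_(tnth k i)}}|.
(* From [q ^ M] on, the constant [M] is at most [log_q n]; the second threshold is the size that the
   long path needs. *)
exists (maxn (q ^ M) (q * K.+1)) => n; rewrite geq_max => /andP[n_M n_K].
have n_gt1 : 1 < n by apply: leq_trans n_K; apply: leq_trans q_gt1 _; rewrite leq_pmulr.
have K_n : K < n by apply: leq_trans n_K; rewrite leq_pmull // ltnW.
rewrite q_real; split.
  apply: (log_base_sub1_le _ q_gt1 (ltnW n_gt1)).
  apply: leq_trans (long_path_graph_slow hk k_le k1_k K_n n_K) _.
  rewrite (leq_exp2l _ _ q_gt1) ltnS.
  have G_simple := long_path_graph_simple hk K_n.
  rewrite /max_running_time (bigD1 (long_path_graph K_n)) //=; exact: leq_maxl.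
have /andP[/ltnW lt_j le_j] := up_log_bounds q_gt1 n_gt1.
set j := up_log q n in lt_j le_j.
have upper : max_running_time (union_of_cycles k) n <= maxn M (j + q.+1 ^ 2 + q.*2.*2 + 10).
  by apply/bigmax_leqP => G G_simple; apply: HM.
have -> : (6 * s%:R ^+ 6 * k1%:R ^+ 2 = (6 * s ^ 6 * k1 ^ 2)%N%:R :> R)%R.
  by rewrite -!GRing.natrX -!GRing.natrM.
(* The left side bounds the additive terms of [upper] relative to [j.-1], the exponent with
   [q ^ j.-1 <= n]. The factor [s ^ 6], at least 64, leaves ample room. *)
have large : k1 ^ 2 + k1 * 4 + 11 < 6 * s ^ 6 * k1 ^ 2.
  have s6 : 2 ^ 6 <= s ^ 6 by rewrite (leq_exp2r _ _ (isT : 0 < 6)); apply: hs.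
  have : 6 * 2 ^ 6 * k1 ^ 2 <= 6 * s ^ 6 * k1 ^ 2.
    exact: (leq_mul (leq_mul (leqnn 6) s6) (leqnn (k1 ^ 2))).
  by apply: leq_trans; rewrite -mulnn; clear -k1_ge3; nia.
move: upper; rewrite leq_max => /orP[le_M|le].
  by apply: (@lt_log_base_add _ q n M 0); rewrite ?addn0 // (leq_ltn_trans _ large).
apply: (@lt_log_base_add _ q n j.-1 (k1 ^ 2 + k1 * 4 + 11)) => //.
by apply: leq_trans le _; rewrite -k1E; clear -k1E; lia.
Qed.
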